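(* Let $\mathcal T$ be a triangular algebra of size $n\ge3$ over a field $k$, $X$ a $\mathcal T$-bimodule, and $E_r^{t,s}$ the spectral sequence associated with the filtration by length of trajectories of the relative Hochschild complex of $\mathcal T$ with coefficients in $X$. Assume the following projectivity hypothesis: for every $t\ge2$, every sequence $1\le k_1<\dots<k_{t+1}\le n$, every $2\le i\le t$ and all $p_{i+1},\dots,p_t\ge0$, the $A_{k_i}^e$-module ${}_{k_{t+1}}M_{k_t}\otimes A_{k_t}^{\otimes p_t}\otimes\dots\otimes A_{k_{i+1}}^{\otimes p_{i+1}}\otimes{}_{k_{i+1}}M_{k_i}\otimes\big({}_{k_i}M_{k_{i-1}}\otimes_{A_{k_{i-1}}}\dots\otimes_{A_{k_2}}{}_{k_2}M_{k_1}\big)$ is projective. Let $t>0$, let $1\le k_1<\dots<k_{t+1}\le n$, and let $$f:\ A_{k_{t+1}}^{\otimes p_{t+1}}\otimes{}_{k_{t+1}}M_{k_t}\otimes A_{k_t}^{\otimes p_t}\otimes\dots\otimes A_{k_2}^{\otimes p_2}\otimes{}_{k_2}M_{k_1}\otimes A_{k_1}^{\otimes p_1}\longrightarrow{}_{k_{t+1}}X_{k_1},\qquad p_1+\dots+p_{t+1}=l,$$ represent an element of the component $\mathrm{Ext}^l_{A_{k_{t+1}}-A_{k_1}}\big({}_{k_{t+1}}M_{k_t}\otimes_{A_{k_t}}\dots\otimes_{A_{k_2}}{}_{k_2}M_{k_1},{}_{k_{t+1}}X_{k_1}\big)$ of $E_1^{t,l}$. Then the differential $d_1^{t,l}$ restricted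 to this component is given by $$d_1^{t,l}f=\sum_{k_{t+2}=k_{t+1}+1}^n1_{{}_{k_{t+2}}M_{k_{t+1}}}\cup f+\sum_{k_0=1}^{k_1-1}(-1)^{l+2}f\cup 1_{{}_{k_1}M_{k_0}}$$ $$+\sum_{i=1}^t\sum_{\alpha=k_i+1}^{k_{i+1}-1}(-1)^{p_{t+1}+\dots+p_{i+1}+t-i+1}f\circ\big(1^{\otimes(p_{t+1}+\dots+p_{i+1}+t-i)}\otimes\mu_{k_{i+1},\alpha,k_i}\otimes1^{\otimes(p_i+\dots+p_1+i-1)}\big).$$
   Context: Throughout, $k$ is a field, $\otimes=\otimes_k$; bimodules over $k$-algebras have $k$ acting centrally. $\mathrm{Ext}_{B-A}$ is Ext of $B$-$A$-bimodules. $A_j^e=A_j\otimes A_j^{op}$; in the hypothesis, the $A_{k_i}^e$-structure comes from the right action on ${}_{k_{i+1}}M_{k_i}$ and the left action on ${}_{k_i}M_{k_{i-1}}$. Triangular algebra of size $n$: $A_1,\dots,A_n$ are unital associative $k$-algebras; for all $1\le i<j\le n$, ${}_jM_i$ is a nonzero $A_j$-$A_i$-bimodule; for all $i<j<l$, $\mu_{l,j,i}:{}_lM_j\otimes{}_jM_i\to{}_lM_i$ is an $A_l$-$A_i$-bimodule morphism that is $A_j$-balanced, with $\mu_{m,l,i}\circ(1\otimes\mu_{l,j,i})=\mu_{m,j,i}\circ(\mu_{m,l,j}\otimes1)$ for all $i<j<l<m$. $\mathcal T$ is the $k$-algebra of lower triangular $n\times n$ matrices with $(i,i)$ entry in $A_i$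 and $(j,i)$ entry in ${}_jM_i$ ($j>i$), with matrix multiplication. $e_i\in\mathcal T$ is the image of $1_{A_i}$; $R=\bigoplus_ike_i\subset\mathcal T$; ${}_jX_i=e_jXe_i$. The relative Hochschild complex $\mathcal H$ has $\mathcal H^m=\mathrm{Hom}_{R-R}(\mathcal T^{\otimes_R m},X)$ ($R$-bimodule morphisms; $\mathcal T^{\otimes_R 0}=R$) with the Hochschild coboundary: $x\mapsto(t\mapsto tx-xt)$ in degree $0$ and $(\delta f)(t_1\otimes\dots\otimes t_{m+1})=t_1f(t_2\otimes\dots\otimes t_{m+1})+\sum_{i=1}^m(-1)^if(\dots\otimes t_it_{i+1}\otimes\dots)+(-1)^{m+1}f(t_1\otimes\dots\otimes t_m)t_{m+1}$. The quiver of $\mathcal T$ is $e_1\to\dots\to e_n$. To the trivial path at $e_i$ is associated $M_{e_i}=A_i$, to the path $\gamma$ from $e_i$ to $e_j$ ($i<j$) is associated $M_\gamma={}_jM_i$. An $m$-trajectory is a sequence $\tau=(\gamma_m,\dots,\gamma_1)$ of consecutive paths (trivial ones allowed; for $m=0$, a vertex); $M_\tau=M_{\gamma_m}\otimes\dots\otimes M_{\gamma_1}$ ($=ke_i$ for the $0$-trajectory $e_i$), and $|\tau|$ is the number of non-trivial $\gamma_i$. Then $\mathcal T^{\otimes_Rm}=\bigoplus_\tau M_\tau$, and $F^t\mathcal H^m=\mathrm{Hom}_{R-R}(\bigoplus_{|\tau|\ge t}M_\tau,X)$ (maps vanishing on $M_\tau$ with $|\tau|<t$) defines a decreasing filtration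 of $\mathcal H$. The spectral sequence has $E_0^{t,s}=F^t\mathcal H^{t+s}/F^{t+1}\mathcal H^{t+s}$. Identification: $E_0^{t,l}=\bigoplus_{k_1<\dots<k_{t+1}}\bigoplus_{p_1+\dots+p_{t+1}=l}\mathrm{Hom}_k\big(A_{k_{t+1}}^{\otimes p_{t+1}}\otimes{}_{k_{t+1}}M_{k_t}\otimes\dots\otimes{}_{k_2}M_{k_1}\otimes A_{k_1}^{\otimes p_1},{}_{k_{t+1}}X_{k_1}\big)$, and under the projectivity hypothesis the $d_0$-cohomology of the summand for $(k_1,\dots,k_{t+1})$ is the indicated Ext group. A cocycle is in general a sum of such $f$ over the exponents $(p_1,\dots,p_{t+1})$, and the formula is extended additively. Cup products: $1_N$ is the identity of $N$; $(1_{{}_{k_{t+2}}M_{k_{t+1}}}\cup f)(y,z_1,z_2,\dots)=y\,f(z_1,z_2,\dots)$ and $(f\cup 1_{{}_{k_1}M_{k_0}})(z_1,z_2,\dots,x)=f(z_1,z_2,\dots)\,x$, the products coming from the $\mathcal T$-bimodule structure of $X$.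
   Formalization: The sign (-1)^{l+2} of the terms f∪1 is replaced by (-1)^{l+t+1}, the sign of the last term of the Hochschild coboundary in degree t+l; the two agree for odd t, and for even t the printed sign is wrong unless char k = 2. *)

(* Defs.v *)
From HB Require Import structures.
From mathcomp Require Import all_boot all_order all_algebra.
From mathcomp Require Import boolp classical_sets functions.

Set Implicit Arguments.
Unset Strict Implicit.
Unset Printing Implicit Defensive.

Import GRing.Theory.
Local Open Scope classical_set_scope.
Local Open Scope ring_scope.

(* A B-A-bimodule with k acting centrally: the actions of B and A are
   k-bilinear for one and the same k-module structure of the carrier. *)
Record bimod (k : fieldType) (B A : algType k) := Bimod {
  bcar :> lmodType k;
  lact : B -> bcar -> bcar;
  ract : bcar -> A -> bcar;
  lact_linl : forall (c : k) b b' x,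
    lact (c *: b + b') x = c *: lact b x + lact b' x;
  lact_linr : forall (c : k) b x y,
    lact b (c *: x + y) = c *: lact b x + lact b y;
  lact1 : forall x, lact 1 x = x;
  lactM : forall b b' x, lact (b * b') x = lact b (lact b' x);
  ract_linl : forall (c : k) x y a,
    ract (c *: x + y) a = c *: ract x a + ract y a;
  ract_linr : forall (c : k) x a a',
    ract x (c *: a + a') = c *: ract x a + ract x a';
  ract1 : forall x, ract x 1 = x;
  ractM : forall x a a', ract x (a * a') = ract (ract x a) a';
  lractA : forall b x a, ract (lact b x) a = lact b (ract x a)
}.

Lemma add_idem (V : zmodType) (x : V) : x = x + x -> x = 0.
Proof. by move/(congr1 (fun u => u - x)); rewrite addrK subrr. Qed.

Arguments lact_linl {k B A V} c b b' x : rename.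
Arguments lact_linr {k B A V} c b x y : rename.
Arguments lact1 {k B A V} x : rename.
Arguments lactM {k B A V} b b' x : rename.
Arguments ract_linl {k B A V} c x y a : rename.
Arguments ract_linr {k B A V} c x a a' : rename.
Arguments ract1 {k B A V} x : rename.
Arguments ractM {k B A V} x a a' : rename.
Arguments lractA {k B A V} b x a : rename.

Section Bimodules.
Context {k : fieldType} {B A : algType k}.

Definition bimod_morph (U V : bimod B A) (h : {linear U -> V}) : Prop :=
  (forall b x, h (lact b x) = lact b (h x)) /\
  (forall x a, h (ract x a) = ract (h x) a).

(* B-A-bimodules with central action of k are the (B (x) A^op)-modules; in
   particular, for B = A, these are the projective A^e-modules. *)
Definition projective (P : bimod B A) : Prop :=
  forall (U V : bimod B A) (g : {linear U -> V}) (h : {linear P -> V}),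
    bimod_morph g -> bimod_morph h -> (forall v, exists u, g u = v) ->
    exists2 h' : {linear P -> U}, bimod_morph h' & forall x, g (h' x) = h x.

Record projective_resolution (N : bimod B A) := ProjRes {
  res :> nat -> bimod B A;
  res_d : forall m, {linear res m.+1 -> res m};
  res_eps : {linear res 0 -> N};
  res_proj : forall m, projective (res m);
  res_d_morph : forall m, bimod_morph (res_d m);
  res_eps_morph : bimod_morph res_eps;
  res_eps_surj : forall x, exists y, res_eps y = x;
  res_exact0 : forall x, res_eps x = 0 <-> exists y, res_d 0 y = x;
  res_exactS : forall m x, res_d m x = 0 <-> exists y, res_d m.+1 y = x
}.

Lemma lact0 (V : bimod B A) b : lact b (0 : V) = 0.
Proof.
have := lact_linr (V := V) 1 b 0 0.
by rewrite !scale1r addr0 => /add_idem.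
Qed.

Lemma ract0 (V : bimod B A) a : ract (0 : V) a = 0.
Proof.
have := ract_linl (V := V) 1 0 0 a.
by rewrite !scale1r addr0 => /add_idem.
Qed.

Lemma act0l (V : bimod B A) (x : V) : lact 0 x = 0.
Proof.
have := lact_linl (V := V) 1 0 0 x.
by rewrite !scale1r addr0 => /add_idem.
Qed.

Lemma act0r (V : bimod B A) (x : V) : ract x 0 = 0.
Proof.
have := ract_linr (V := V) 1 x 0 0.
by rewrite !scale1r addr0 => /add_idem.
Qed.

Lemma lactD (V : bimod B A) b (x y : V) : lact b (x + y) = lact b x + lact b y.
Proof. by have := lact_linr 1 b x y; rewrite !scale1r. Qed.

Lemma ractD (V : bimod B A) a (x y : V) : ract (x + y) a = ract x a + ract y a.
Proof. by have := ract_linl 1 x y a; rewrite !scale1r. Qed.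

Lemma lactDl (V : bimod B A) b b' (x : V) :
  lact (b + b') x = lact b x + lact b' x.
Proof. by have := lact_linl 1 b b' x; rewrite !scale1r. Qed.

Lemma ractDr (V : bimod B A) a a' (x : V) :
  ract x (a + a') = ract x a + ract x a'.
Proof. by have := ract_linr 1 x a a'; rewrite !scale1r. Qed.

Lemma lactZ (V : bimod B A) c b (x : V) : lact b (c *: x) = c *: lact b x.
Proof. by have := lact_linr c b x 0; rewrite lact0 !addr0. Qed.

Lemma lactZl (V : bimod B A) c b (x : V) : lact (c *: b) x = c *: lact b x.
Proof. by have := lact_linl c b 0 x; rewrite act0l !addr0. Qed.

Lemma ractZ (V : bimod B A) c a (x : V) : ract (c *: x) a = c *: ract x a.
Proof. by have := ract_linl c x 0 a; rewrite ract0 !addr0. Qed.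

Lemma ractZr (V : bimod B A) c a (x : V) : ract x (c *: a) = c *: ract x a.
Proof. by have := ract_linr c x a 0; rewrite act0r !addr0. Qed.

Lemma lact_sum (V : bimod B A) b (I : Type) (r : seq I) (P : pred I)
    (F : I -> V) :
  lact b (\sum_(i <- r | P i) F i) = \sum_(i <- r | P i) lact b (F i).
Proof. exact: (big_morph _ (lactD b) (lact0 V b)). Qed.

Lemma ract_sum (V : bimod B A) a (I : Type) (r : seq I) (P : pred I)
    (F : I -> V) :
  ract (\sum_(i <- r | P i) F i) a = \sum_(i <- r | P i) ract (F i) a.
Proof. exact: (big_morph (fun x : V => ract x a) (ractD a) (ract0 V a)). Qed.

End Bimodules.

(* The indices 1, ..., n are shifted to 0, ..., n-1. The families [offM] and
   [tmu] are total for convenience, but every condition concerns indices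
   i < j < l < m only and the algebra [trimx] below does not see the other
   values. Since n >= 2 and [offM j i] is nonzero for i < j, the algebras
   [diagA i] are automatically nonzero, as [algType] demands. *)
Record triangular (k : fieldType) (n : nat) := Triangular {
  tri_gt0 : (0 < n)%N;
  diagA : 'I_n -> algType k;
  offM : forall j i : 'I_n, bimod (diagA j) (diagA i);
  tmu : forall l j i : 'I_n, offM l j -> offM j i -> offM l i;
  offM_neq0 : forall j i : 'I_n, (i < j)%N -> exists x : offM j i, x != 0;
  tmu_linl : forall l j i : 'I_n, (i < j < l)%N ->
    forall (c : k) x x' (y : offM j i),
    @tmu l j i (c *: x + x') y = c *: tmu x y + tmu x' y;
  tmu_linr : forall l j i : 'I_n, (i < j < l)%N ->
    forall (c : k) (x : offM l j) y y',
    @tmu l j i x (c *: y + y') = c *: tmu x y + tmu x y';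
  tmu_lact : forall l j i : 'I_n, (i < j < l)%N ->
    forall a (x : offM l j) (y : offM j i),
    tmu (lact a x) y = lact a (tmu x y);
  tmu_ract : forall l j i : 'I_n, (i < j < l)%N ->
    forall a (x : offM l j) (y : offM j i),
    tmu x (ract y a) = ract (tmu x y) a;
  tmu_bal : forall l j i : 'I_n, (i < j < l)%N ->
    forall a (x : offM l j) (y : offM j i),
    tmu (ract x a) y = tmu x (lact a y);
  tmuA : forall m l j i : 'I_n, (i < j)%N -> (j < l)%N -> (l < m)%N ->
    forall (x : offM m l) (y : offM l j) (z : offM j i),
    tmu x (tmu y z) = tmu (tmu x y) z
}.

Section TriangularAlgebra.
Context {k : fieldType} {n : nat} (D : triangular k n).
Local Notation A := (diagA D).
Local Notation M := (offM D).

Record trimx := TriMx {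
  dg : forall i, A i;
  lo : forall j i, M j i;
  lo_supp : forall j i : 'I_n, ~~ (i < j)%N -> lo j i = 0
}.

Lemma trimxP (x y : trimx) :
  (forall i, dg x i = dg y i) -> (forall j i, lo x j i = lo y j i) -> x = y.
Proof.
case: x y => [d1 l1 s1] [d2 l2 s2] /= ed el.
have ed' : d1 = d2 by apply: functional_extensionality_dep.
have el' : l1 = l2.
  apply: functional_extensionality_dep => j.
  exact: functional_extensionality_dep.
by subst; congr TriMx; exact: Prop_irrelevance.
Qed.

HB.instance Definition _ := gen_eqMixin trimx.
HB.instance Definition _ := gen_choiceMixin trimx.

Program Definition tri_zero := @TriMx (fun i => 0) (fun j i => 0) _.
Program Definition tri_opp (x : trimx) :=
  @TriMx (fun i => - dg x i) (fun j i => - lo x j i) _.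
Next Obligation. by rewrite lo_supp ?oppr0. Qed.
Program Definition tri_add (x y : trimx) :=
  @TriMx (fun i => dg x i + dg y i) (fun j i => lo x j i + lo y j i) _.
Next Obligation. by rewrite !lo_supp ?addr0. Qed.
Program Definition tri_scale (c : k) (x : trimx) :=
  @TriMx (fun i => c *: dg x i) (fun j i => c *: lo x j i) _.
Next Obligation. by rewrite lo_supp ?scaler0. Qed.
Program Definition tri_one := @TriMx (fun i => 1) (fun j i => 0) _.

Program Definition tri_mul (x y : trimx) :=
  @TriMx (fun i => dg x i * dg y i)
    (fun j i => lact (dg x j) (lo y j i) + ract (lo x j i) (dg y i)
                + \sum_(l < n | (i < l < j)%N) tmu (lo x j l) (lo y l i)) _.
Next Obligation.
rewrite !lo_supp // lact0 ract0 !add0r big1 // => l /andP[il lj].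
by move: H; rewrite (ltn_trans il lj).
Qed.

Fact tri_addA : associative tri_add.
Proof. by move=> x y z; apply: trimxP => *; rewrite /= addrA. Qed.
Fact tri_addC : commutative tri_add.
Proof. by move=> x y; apply: trimxP => *; rewrite /= addrC. Qed.
Fact tri_add0 : left_id tri_zero tri_add.
Proof. by move=> x; apply: trimxP => *; rewrite /= add0r. Qed.
Fact tri_addN : left_inverse tri_zero tri_opp tri_add.
Proof. by move=> x; apply: trimxP => *; rewrite /= addNr. Qed.

HB.instance Definition _ :=
  GRing.isZmodule.Build trimx tri_addA tri_addC tri_add0 tri_addN.

Lemma tmuDl (l j i : 'I_n) : (i < j < l)%N -> forall x x' (y : M j i),
  @tmu _ _ D l j i (x + x') y = tmu x y + tmu x' y.
Proof. by move=> h x x' y; have := tmu_linl h 1 x x' y; rewrite !scale1r. Qed.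
Lemma tmuDr (l j i : 'I_n) : (i < j < l)%N -> forall (x : M l j) y y',
  @tmu _ _ D l j i x (y + y') = tmu x y + tmu x y'.
Proof. by move=> h x y y'; have := tmu_linr h 1 x y y'; rewrite !scale1r. Qed.
Lemma tmu0l (l j i : 'I_n) : (i < j < l)%N -> forall y : M j i,
  @tmu _ _ D l j i 0 y = 0.
Proof.
move=> h y; have := tmuDl h 0 0 y.
by rewrite addr0 => /add_idem.
Qed.
Lemma tmu0r (l j i : 'I_n) : (i < j < l)%N -> forall x : M l j,
  @tmu _ _ D l j i x 0 = 0.
Proof.
move=> h x; have := tmuDr h x 0 0.
by rewrite addr0 => /add_idem.
Qed.
Lemma tmuZl (l j i : 'I_n) : (i < j < l)%N -> forall c x (y : M j i),
  @tmu _ _ D l j i (c *: x) y = c *: tmu x y.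
Proof. by move=> h c x y; have := tmu_linl h c x 0 y; rewrite tmu0l ?addr0. Qed.
Lemma tmuZr (l j i : 'I_n) : (i < j < l)%N -> forall c (x : M l j) y,
  @tmu _ _ D l j i x (c *: y) = c *: tmu x y.
Proof. by move=> h c x y; have := tmu_linr h c x y 0; rewrite tmu0r ?addr0. Qed.

Fact tri_mulA : associative tri_mul.
Proof.
move=> x y z; apply: trimxP => [i|j i] /=; first by rewrite mulrA.
rewrite !lactD !ractD !lactM !ractM lact_sum ract_sum lractA.
have -> : \sum_(l < n | (i < l < j)%N)
    tmu (lo x j l) (lact (dg y l) (lo z l i) + ract (lo y l i) (dg z i)
      + \sum_(l0 < n | (i < l0 < l)%N) tmu (lo y l l0) (lo z l0 i)) =
  \sum_(l < n | (i < l < j)%N) tmu (ract (lo x j l) (dg y l)) (lo z l i) +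
  (\sum_(l < n | (i < l < j)%N) ract (tmu (lo x j l) (lo y l i)) (dg z i) +
   \sum_(l < n | (i < l < j)%N) \sum_(l0 < n | (i < l0 < l)%N)
     tmu (tmu (lo x j l) (lo y l l0)) (lo z l0 i)).
  rewrite -!big_split /=; apply: eq_bigr => l lt; rewrite !tmuDr // -addrA.
  rewrite tmu_bal // tmu_ract //; congr (_ + (_ + _)).
  rewrite (big_morph _ (tmuDr lt _) (tmu0r lt _)).
  case/andP: lt => il lj; apply: eq_bigr => l0 /andP[il0 l0l].
  by rewrite tmuA.
have -> : \sum_(l < n | (i < l < j)%N)
   tmu (lact (dg x j) (lo y j l) + ract (lo x j l) (dg y l)
      + \sum_(l0 < n | (l < l0 < j)%N) tmu (lo x j l0) (lo y l0 l)) (lo z l i) =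
  \sum_(l < n | (i < l < j)%N) lact (dg x j) (tmu (lo y j l) (lo z l i)) +
  (\sum_(l < n | (i < l < j)%N) tmu (ract (lo x j l) (dg y l)) (lo z l i) +
   \sum_(l < n | (i < l < j)%N) \sum_(l0 < n | (l < l0 < j)%N)
     tmu (tmu (lo x j l0) (lo y l0 l)) (lo z l i)).
  rewrite -!big_split /=; apply: eq_bigr => l lt; rewrite !tmuDl // -addrA.
  rewrite tmu_lact //; congr (_ + (_ + _)).
  by rewrite (big_morph _ (fun u v => tmuDl lt u v _) (tmu0l lt _)).
have -> : \sum_(l < n | (i < l < j)%N) \sum_(l0 < n | (i < l0 < l)%N)
     tmu (tmu (lo x j l) (lo y l l0)) (lo z l0 i) =
  \sum_(l < n | (i < l < j)%N) \sum_(l0 < n | (l < l0 < j)%N)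
     tmu (tmu (lo x j l0) (lo y l0 l)) (lo z l i).
  rewrite (exchange_big_dep (fun l0 : 'I_n => (i < l0 < j)%N)) /=; last first.
    move=> l l0 /andP[_ lj] /andP[il0 l0l].
    by rewrite il0 (ltn_trans l0l lj).
  apply: eq_bigr => l0 /andP[il0 l0j]; apply: eq_bigl => l.
  rewrite il0 /=; case: (ltnP l0 l) => h; rewrite ?andbF ?andbT //=.
  by rewrite (ltn_trans il0 h).
rewrite -!addrA; congr (_ + _); congr (_ + _).
rewrite addrCA; congr (_ + _).
by rewrite [RHS]addrCA; congr (_ + _); exact: addrCA.
Qed.

Fact tri_mul1 : left_id tri_one tri_mul.
Proof.
move=> x; apply: trimxP => [i|j i] /=; first by rewrite mul1r.
rewrite lact1 ract0 addr0 big1 ?addr0 // => l lt; exact: tmu0l.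
Qed.
Fact tri_mulr1 : right_id tri_one tri_mul.
Proof.
move=> x; apply: trimxP => [i|j i] /=; first by rewrite mulr1.
rewrite ract1 lact0 add0r big1 ?addr0 // => l lt; exact: tmu0r.
Qed.
Fact tri_mulDl : left_distributive tri_mul tri_add.
Proof.
move=> x y z; apply: trimxP => [i|j i] /=; first by rewrite mulrDl.
rewrite lactDl ractD (eq_bigr _ (fun l lt => tmuDl lt _ _ _)) big_split /=.
by rewrite [RHS]addrACA; congr (_ + _); rewrite addrACA.
Qed.
Fact tri_mulDr : right_distributive tri_mul tri_add.
Proof.
move=> x y z; apply: trimxP => [i|j i] /=; first by rewrite mulrDr.
rewrite lactD ractDr (eq_bigr _ (fun l lt => tmuDr lt _ _ _)) big_split /=.
by rewrite [RHS]addrACA; congr (_ + _); rewrite addrACA.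
Qed.
Fact tri_1neq0 : tri_one != tri_zero.
Proof.
apply/eqP => /(congr1 (fun x : trimx => dg x (Ordinal (tri_gt0 D)))) /=.
by move/eqP; rewrite oner_eq0.
Qed.

HB.instance Definition _ := GRing.Zmodule_isNzRing.Build trimx
  tri_mulA tri_mul1 tri_mulr1 tri_mulDl tri_mulDr tri_1neq0.

Fact tri_scaleA c d x : tri_scale c (tri_scale d x) = tri_scale (c * d) x.
Proof. by apply: trimxP => *; rewrite /= scalerA. Qed.
Fact tri_scale1 : left_id 1 tri_scale.
Proof. by move=> x; apply: trimxP => *; rewrite /= scale1r. Qed.
Fact tri_scaleDr : right_distributive tri_scale tri_add.
Proof. by move=> c x y; apply: trimxP => *; rewrite /= scalerDr. Qed.
Fact tri_scaleDl x c d : tri_scale (c + d) x = tri_scale c x + tri_scale d x.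
Proof. by apply: trimxP => *; rewrite /= scalerDl. Qed.

HB.instance Definition _ := GRing.Zmodule_isLmodule.Build k trimx
  tri_scaleA tri_scale1 tri_scaleDr tri_scaleDl.

Fact tri_scaleAl (c : k) (x y : trimx) : c *: (x * y) = (c *: x) * y.
Proof.
apply: trimxP => [i|j i] /=; first by rewrite scalerAl.
rewrite lactZl ractZ (eq_bigr _ (fun l lt => tmuZl lt _ _ _)) -scaler_sumr.
by rewrite -!scalerDr.
Qed.

HB.instance Definition _ :=
  GRing.Lmodule_isLalgebra.Build k trimx tri_scaleAl.

Fact tri_scaleAr (c : k) (x y : trimx) : c *: (x * y) = x * (c *: y).
Proof.
apply: trimxP => [i|j i] /=; first by rewrite scalerAr.
rewrite lactZ ractZr (eq_bigr _ (fun l lt => tmuZr lt _ _ _)) -scaler_sumr.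
by rewrite -!scalerDr.
Qed.

HB.instance Definition _ :=
  GRing.Lalgebra_isAlgebra.Build k trimx tri_scaleAr.

End TriangularAlgebra.

Section Hochschild.
Context {k : fieldType} {n : nat} {D : triangular k n}.
Local Notation A := (diagA D).
Local Notation M := (offM D).
Local Notation T := (trimx D).

Definition inA (i : 'I_n) (a : A i) : T :=
  @TriMx _ _ D (dfwith (fun _ => 0) a) (fun _ _ => 0) (fun _ _ _ => erefl).

(* The element of T whose only nonzero entry is the entry x at (j, i), i < j. *)
Program Definition inM (j i : 'I_n) (x : M j i) : T :=
  @TriMx _ _ D (fun _ => 0) (fun j' i' => if (i' < j')%N then
    dfwith (fun j0 i0 => 0 : M j0 i0) (dfwith (fun i0 => 0 : M j i0) x) j' i'
    else 0) _.
Next Obligation. by rewrite ifN. Qed.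

Definition idem (i : 'I_n) : T := inA (1 : A i).

Definition subR : set T :=
  [set r | exists c : 'I_n -> k, r = \sum_(i < n) c i *: idem i].

Definition upd (V : Type) m (z : 'I_m -> V) (a : 'I_m) (x : V) : 'I_m -> V :=
  fun b => if b == a then x else z b.

(* z_0, ..., z_(q-1), y, z_(q+2), ..., z_m : the entries at q and q+1 are
   replaced by the single entry y. *)
Definition contract (V : Type) m (z : 'I_m.+1 -> V) (q : nat) (y : V) :
    'I_m -> V :=
  fun a => if (a < q)%N then z (widen_ord (leqnSn m) a)
           else if a == q :> nat then y else z (lift ord0 a).

Definition multilinear (V W : lmodType k) m (f : ('I_m -> V) -> W) : Prop :=
  forall z a (c : k) x y,
    f (upd z a (c *: x + y)) = c *: f (upd z a x) + f (upd z a y).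

(* A linear map on T^{(x) m} is given as the corresponding multilinear map of
   m arguments. The arguments are indexed from left to right by 0, ..., m-1,
   so that the leftmost one is [z ord0]. *)
Definition cochain (X : bimod T T) (m : nat) := ('I_m -> T) -> X.

Section Coefficients.
Variable X : bimod T T.

(* Hom_{R-R}(T^{(x)_R m}, X). For m = 0 an R-bimodule map phi : R -> X is given
   by phi(1), an arbitrary element commuting with R. *)
Definition Hcochain m : set (cochain X m) := [set f |
  [/\ multilinear f,
      forall z (a b : 'I_m) r, subR r -> b = a.+1 :> nat ->
        f (upd z a (z a * r)) = f (upd z b (r * z b)),
      forall z (a : 'I_m) r, subR r -> a = 0%N :> nat ->
        f (upd z a (r * z a)) = lact r (f z),
      forall z (a : 'I_m) r, subR r -> a.+1 = m ->
        f (upd z a (z a * r)) = ract (f z) r &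
      forall z r, subR r -> m = 0%N -> lact r (f z) = ract (f z) r]].

Definition delta m (f : cochain X m) : cochain X m.+1 := fun z =>
  lact (z ord0) (f (fun a => z (lift ord0 a)))
  + \sum_(i < m) (-1) ^+ i.+1 *:
      f (contract z i (z (widen_ord (leqnSn m) i) * z (lift ord0 i)))
  + (-1) ^+ m.+1 *: ract (f (fun a => z (widen_ord (leqnSn m) a))) (z ord_max).

(* A trajectory of length m is the sequence v 0 >= v 1 >= ... >= v m of the
   vertices met by its paths, read from left to right: its leftmost path goes
   from e_(v 1) to e_(v 0). Only the values v 0, ..., v m matter. *)
Definition trajectory (m : nat) (v : nat -> 'I_n) : Prop :=
  forall a, (a < m)%N -> (v a.+1 <= v a)%N.

Definition traj_len (m : nat) (v : nat -> 'I_n) : nat :=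
  (\sum_(a < m) (v a != v a.+1))%N.

(* The projection of T x ... x T onto the product of the spaces
   e_(v a) T e_(v (a+1)), whose tensor product is M_v. *)
Definition tproj m (v : nat -> 'I_n) (z : 'I_m -> T) : 'I_m -> T :=
  fun a => idem (v a) * z a * idem (v a.+1).

(* The factor e_(v 0) has no effect on [Hcochain m] for m > 0; for m = 0 it
   expresses that phi(e_(v 0)) = e_(v 0) phi(1) is zero. *)
Definition vanishes_on m (v : nat -> 'I_n) (f : cochain X m) : Prop :=
  forall z, lact (idem (v 0)) (f (tproj v z)) = 0.

Definition Filt (t m : nat) : set (cochain X m) := [set f |
  Hcochain f /\
  forall v, trajectory m v -> (traj_len m v < t)%N -> vanishes_on v f].

(* The spectral sequence of a decreasing filtration:
    Z_r^t = { f in F^t | delta f in F^(t+r) } and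
    E_r^t = Z_r^t / (Z_(r-1)^(t+1) + delta Z_(r-1)^(t-r+1)),
    with F^s = F^0 for s < 0 and Z_(-1) = F. The elements of E_r are cosets.
    The second degree s of E_r^{t,s} is replaced by the total degree
    m = t + s. *)
Definition Zr (r t m : nat) : set (cochain X m) := [set f |
  Filt t f /\ Filt (t + r)%N (delta f)].

Definition Br (r t m : nat) : set (cochain X m) :=
  match m with
  | 0 => [set 0]
  | m'.+1 => [set h | exists g : cochain X m',
                [/\ Filt (t.+1 - r)%N g, Filt t (delta g) & h = delta g]]
  end.

Definition Er_zero (r t m : nat) : set (cochain X m) :=
  [set f | exists x y, [/\ Zr r.-1 t.+1 x, Br r t y & f = x + y]].

Definition Er_class (r t m : nat) (f : cochain X m) : set (cochain X m) :=
  [set g | Zr r t g /\ Er_zero r t (g - f)].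

Definition Er (r t m : nat) : set (set (cochain X m)) :=
  [set c | exists2 f, Zr r t f & c = Er_class r t f].

Definition dr (r t m : nat) (c : set (cochain X m)) : set (cochain X m.+1) :=
  [set h | exists2 f, c f & Er_class r (t + r)%N (delta f) h].

End Coefficients.
End Hochschild.

Section Tensor.
Context {k : fieldType} {n : nat} {D : triangular k n}.
Local Notation A := (diagA D).
Local Notation M := (offM D).
Local Notation T := (trimx D).

(* A linear map on M_v, where v is a trajectory of length m, is given as a
   multilinear map that only depends on the entries z_a in
   e_(v a) T e_(v (a+1)). It is balanced over A_(v b) at the tensor sign
   preceding the factor of index b for the b selected by S, and only over k
   elsewhere. *)
Definition balanced_map (m : nat) (v : nat -> 'I_n) (S : pred nat)
    (W : lmodType k) (u : ('I_m -> T) -> W) : Prop :=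
  [/\ multilinear u, forall z, u z = u (tproj v z) &
      forall z (a b : 'I_m) (x : A (v b)), S b -> b = a.+1 :> nat ->
        u (upd z a (z a * inA x)) = u (upd z b (inA x * z b))].

(* u exhibits W as the tensor product of the factors of M_v, taken over A_(v b)
   before the factors of index b in S and over k elsewhere. *)
Definition is_tensor (m : nat) (v : nat -> 'I_n) (S : pred nat)
    (W : lmodType k) (u : ('I_m -> T) -> W) : Prop :=
  balanced_map v S u /\
  forall (Y : lmodType k) (g : ('I_m -> T) -> Y), balanced_map v S g ->
    exists2 h : {linear W -> Y}, (forall z, g z = h (u z)) &
      forall h' : {linear W -> Y}, (forall z, g z = h' (u z)) -> h' =1 h.

(* The left action of A_j on W is the left action on the factor of index q,
   and the right action of A_i is the right action on the factor of index
   q' - 1. *)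
Definition tensor_actions (m : nat) (q q' : nat) (j i : 'I_n)
    (W : bimod (A j) (A i)) (u : ('I_m -> T) -> W) : Prop :=
  (forall z (b : 'I_m) (x : A j), b = q :> nat ->
     lact x (u z) = u (upd z b (inA x * z b))) /\
  (forall z (a : 'I_m) (x : A i), a.+1 = q' ->
     ract (u z) x = u (upd z a (z a * inA x))).

Definition increasing (t : nat) (kk : 'I_t.+1 -> 'I_n) : Prop :=
  forall i j : 'I_t.+1, (i < j)%N -> (kk i < kk j)%N.

(* The trajectory with space
   A_(k_t)^p_t (x) M_(k_t,k_(t-1)) (x) ... (x) M_(k_1,k_0) (x) A_(k_0)^p_0. *)
Definition traj_of (t : nat) (kk : 'I_t.+1 -> 'I_n) (p : 'I_t.+1 -> nat) :
    nat -> 'I_n :=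
  nth (kk ord0)
    (flatten [seq nseq (p i).+1 (kk i) | i <- rev (enum 'I_t.+1)]).

(* The module is the tensor product W along the trajectory with exponents p,
   where p_j = 0 unless c < j < t. The vertex k_c has L factors on its left;
   the tensor product is taken over k up to this vertex and over the A's after
   it. *)
Definition projectivity_hypothesis : Prop :=
  forall (t : nat) (kk : 'I_t.+1 -> 'I_n), (2 <= t)%N -> increasing kk ->
  forall c : 'I_t.+1, (1 <= c < t)%N ->
  forall p : 'I_t.+1 -> nat, (forall j : 'I_t.+1, ~~ (c < j < t)%N -> p j = 0%N) ->
  let L := (\sum_(j < t.+1 | (c < j)%N) p j + (t - c))%N in
  forall (W : bimod (A (kk c)) (A (kk c)))
         (u : ('I_(\sum_j p j + t)%N -> T) -> W),
    is_tensor (traj_of kk p) (fun b => (L < b)%N) u ->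
    tensor_actions L L u ->
    projective W.

End Tensor.

Arguments projectivity_hypothesis {k n} D.

Section Components.
Context {k : fieldType} {n : nat} {D : triangular k n}.
Local Notation A := (diagA D).
Local Notation M := (offM D).
Local Notation T := (trimx D).

(* An A_j-A_i-bimodule as a T-bimodule, along the projections of T onto its
   diagonal entries. *)
Program Definition inflation (j i : 'I_n) (W : bimod (A j) (A i)) :
    bimod T T :=
  @Bimod _ T T W (fun x w => lact (dg x j) w) (fun w x => ract w (dg x i))
    _ _ _ _ _ _ _ _ _.
Next Obligation. exact: lact_linl. Qed.
Next Obligation. exact: lact_linr. Qed.
Next Obligation. exact: lact1. Qed.
Next Obligation. exact: lactM. Qed.
Next Obligation. exact: ract_linl. Qed.
Next Obligation. exact: ract_linr. Qed.
Next Obligation. exact: ract1. Qed.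
Next Obligation. exact: ractM. Qed.
Next Obligation. exact: lractA. Qed.

Variables (t : nat) (kk : 'I_t.+1 -> 'I_n).
Local Notation ktop := (kk ord_max).
Local Notation kbot := (kk ord0).

Definition exponents (l : nat) : pred {ffun 'I_t.+1 -> 'I_l.+1} :=
  fun p => (\sum_i p i == l)%N.

(* Hom_k(M_v, e_(v 0) X e_(v m)), extended by zero to the other summands of
   T^{(x)_R m}. *)
Definition summand (X : bimod T T) m (v : nat -> 'I_n) : set (cochain X m) :=
  [set f | Hcochain f /\ forall z, f z = f (tproj v z)].

Definition component (X : bimod T T) (l : nat) : set (cochain X (l + t)) :=
  [set F | exists2 f : {ffun 'I_t.+1 -> 'I_l.+1} -> cochain X (l + t),
     (forall p, exponents p -> summand (traj_of kk (fun i => p i)) (f p)) &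
     F = \sum_(p | exponents p) f p].

Section Coefficients.
Variable X : bimod T T.

(* F represents an element of Ext^l(N, e_ktop X e_kbot), the Ext of
   A_ktop-A_kbot-bimodules, where N is the tensor product of the
   M_(k_(i+1),k_i) over the algebras A_(k_i). The Ext group is computed from a
   projective resolution P of N, an element being given by a cocycle
   xi : P_l -> e_ktop X e_kbot. It corresponds to the class of xi o phi_l, where
   phi is a comparison map over N from the (bar) resolution whose bimodules
   are the A_ktop (x) M_v (x) A_kbot, for the trajectories v = traj_of kk p, to P. By
   the first two conditions on xi, its values lie in e_ktop X e_kbot. In terms of cochains with values in P this means
   eps o phi_0 = u and d o phi_(j+1) = d_0 phi_j. *)
Definition represents_Ext (l : nat) (F : cochain X (l + t)) : Prop :=
  exists (N : bimod (A ktop) (A kbot)) (u : ('I_t -> T) -> N)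
         (P : projective_resolution N)
         (phi : forall j, cochain (inflation (P j)) (j + t))
         (xi : {linear P l -> X}),
  [/\ is_tensor (traj_of kk (fun _ => 0%N)) predT u /\ tensor_actions 0 t u,
      forall j, component (phi j),
      forall z, res_eps P (phi 0%N z) = u z,
      forall j, Filt t.+1
        ((fun z => res_d P j (phi j.+1 z) - delta (phi j) z)
           : cochain (inflation (P j)) (j + t).+1) &
      [/\ forall b y, xi (lact b y) = lact (inA b) (xi y),
          forall y a, xi (ract y a) = ract (xi y) (inA a),
          forall y, xi (res_d P l y) = 0 &
          Er_class 1 t F = Er_class 1 t ((fun z => xi (phi l z)) : cochain X _)]].

Definition cupl m (j i : 'I_n) (f : cochain X m) : cochain X m.+1 :=
  fun z => lact (inM (lo (z ord0) j i)) (f (fun a => z (lift ord0 a))).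

Definition cupr m (j i : 'I_n) (f : cochain X m) : cochain X m.+1 :=
  fun z => ract (f (fun a => z (widen_ord (leqnSn m) a)))
             (inM (lo (z ord_max) j i)).

(* f o (1^{(x) q} (x) mu_(j,a,i) (x) 1^{(x) m - q - 1}) *)
Definition compmu m (q : nat) (j a i : 'I_n) (f : cochain X m) :
    cochain X m.+1 :=
  fun z => f (contract z q
    (inM (tmu (lo (z (inord q)) j a) (lo (z (inord q.+1)) a i)))).

(* The sign of f cup 1 is the sign (-1)^(m+1) of the last term of the
   Hochschild coboundary in degree m = l + t. It equals (-1)^(l+2) when t is
   odd; for even t the sign (-1)^(l+2) would be wrong, since the two terms
   1 cup f cup 1 of d_1 (d_1 f) would not cancel. In the last sum q is the number of factors to the left of
   M_(k_(i+1),k_i). *)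
Definition d1_formula (l : nat)
    (f : {ffun 'I_t.+1 -> 'I_l.+1} -> cochain X (l + t)) :
    cochain X (l + t).+1 :=
  \sum_(p | exponents p)
   (\sum_(k' < n | (ktop < k')%N) cupl k' ktop (f p)
    + \sum_(k0 < n | (k0 < kbot)%N)
        (-1) ^+ (l + t).+1 *: cupr kbot k0 (f p)
    + \sum_(i < t)
       \sum_(a < n | (kk (widen_ord (leqnSn t) i) < a < kk (lift ord0 i))%N)
         let q := (\sum_(j < t.+1 | (i < j)%N) p j + (t - i.+1))%N in
         (-1) ^+ q.+1 *:
           compmu q (kk (lift ord0 i)) a (kk (widen_ord (leqnSn t) i)) (f p)).

End Coefficients.
End Components.

(* Main.v *)
Require Import Defs.
From HB Require Import structures.
From mathcomp Require Import all_boot all_order all_algebra.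
From mathcomp Require Import boolp classical_sets functions.

Set Implicit Arguments.
Unset Strict Implicit.
Unset Printing Implicit Defensive.

Import GRing.Theory.
Local Open Scope classical_set_scope.
Local Open Scope ring_scope.

(** Why the theorem holds.

    The differential d_1 sends the class of F to the class of [delta F], which
    only matters up to cochains of filtration t+2. As F is a sum of cochains
    living on trajectories of length t, this leaves the values of [delta F] on
    trajectories of length t+1 to be computed. The coboundary is an alternating
    sum of faces, the i-th face composing the two paths that meet at vertex i.
    If f lives on a trajectory w, its i-th face lives on the trajectories v that
    become w when vertex i is removed, and then v is longer than w exactly when
    v_i lies strictly between its neighbours, or strictly beyond the end of w
    when i is the first or the last index ([traj_len_del_vertex]). Hence, in
    length t+1, [delta f] is the sum over all strict insertions of a vertex into
    w ([insertions], [hat_rmul_insertions]). For w = [traj_of kk p] only the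
    places where w leaves one block of equal vertices for the next can receive a
    strict insertion ([sum_jumps]). Inserting before w yields the terms
    1 cup f, inserting after w the terms f cup 1, and inserting between k_i and
    k_(i+1) the terms with mu ([d1_formula_insertions]). What is left of
    [delta F] lives in length at most t, where it cancels because F belongs to
    Z_1 ([delta_sub_insertions]). Independence of the chosen representative,
    which turns this computation into an equality of cosets, rests on
    delta o delta = 0 ([deltaK], [dr_class]).

    For the first claim, let xi o phi_l be the cochain attached to a cocycle xi
    on a projective resolution P. The map xi intertwines the T-bimodule
    structures of P_l and X along diagonal elements of T only. On trajectories
    of length at most t this suffices to get delta (xi o phi_l) = xi o delta
    phi_l, because an outer factor that lies off the diagonal leaves too short
    a trajectory for phi_l ([delta_push]). The right hand side is
    xi o d o phi_(l+1) = 0, so xi o phi_l is in Z_1; and belonging to Z_1 only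
    depends on the class of a cochain ([Er_zero1_Zr]).

    All computations go through [hat f W] = W_0 f(W_1, ..., W_m) W_(m+1), for a
    sequence W indexed by the natural numbers. With the two border entries the
    outer faces look like the inner ones: each face fuses two consecutive
    entries ([hat_face]), the identities between faces reduce to associativity
    ([fuse_fuse]), and being a cochain over R becomes one balancing
    condition at each of the m+1 joints ([hat_balanced]). A trajectory is
    imposed by putting the idempotent e_(v a) at joint a ([rmul]). *)

(** * Corners of the triangular algebra *)

Section Matrices.
Context {k : fieldType} {n : nat} {D : triangular k n}.
Local Notation A := (diagA D).
Local Notation M := (offM D).
Local Notation T := (trimx D).

Lemma dg_inA (i j : 'I_n) (a : A i) :
  dg (inA a : T) j = dfwith (fun _ => 0) a j.
Proof. by []. Qed.

Lemma dg_idem (i j : 'I_n) : dg (idem i : T) j = (j == i)%:R.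
Proof.
rewrite dg_inA; case: eqVneq => [->|ne]; first by rewrite dfwith_in.
by rewrite dfwith_out // eq_sym.
Qed.

Lemma dg_mul (x y : T) i : dg (x * y) i = dg x i * dg y i.
Proof. by []. Qed.

Lemma lo_mul (x y : T) j i : lo (x * y) j i =
  lact (dg x j) (lo y j i) + ract (lo x j i) (dg y i)
  + \sum_(l < n | (i < l < j)%N) tmu (lo x j l) (lo y l i).
Proof. by []. Qed.

Lemma lo_idem_mul e (x : T) j i :
  lo (idem e * x) j i = (j == e)%:R *: lo x j i.
Proof.
rewrite lo_mul dg_idem ract0 addr0 big1 ?addr0; last by move=> l lt; exact: tmu0l.
by case: eqP => _; rewrite ?lact1 ?act0l ?scale1r ?scale0r.
Qed.

Lemma lo_mul_idem e (x : T) j i :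
  lo (x * idem e) j i = (i == e)%:R *: lo x j i.
Proof.
rewrite lo_mul dg_idem lact0 add0r big1 ?addr0; last by move=> l lt; exact: tmu0r.
by case: eqP => _; rewrite ?ract1 ?act0r ?scale1r ?scale0r.
Qed.

Lemma idem_mul (i j : 'I_n) :
  (idem i : T) * idem j = if i == j then idem i else 0.
Proof.
apply: trimxP => [e|e e'].
  rewrite dg_mul !dg_idem; case: (eqVneq i j) => [<-|ne].
    by rewrite dg_idem; case: eqP; rewrite ?mulr1 ?mulr0.
  by case: (eqVneq e i) => [->|_]; rewrite ?mul0r // (negbTE ne) mulr0.
by rewrite lo_mul_idem scaler0; case: ifP.
Qed.

Lemma idemK (i : 'I_n) : (idem i : T) * idem i = idem i.
Proof. by rewrite idem_mul eqxx. Qed.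

(** A factor of a trajectory between two equal vertices belongs to the diagonal
    algebra there; this is what makes outer factors diagonal in [delta_push]. *)
Lemma corner_diag (i : 'I_n) (x : T) : idem i * x * idem i = inA (dg x i).
Proof.
apply: trimxP => [e|e e'].
  rewrite !dg_mul !dg_idem dg_inA; case: (eqVneq e i) => [->|ne].
    by rewrite mul1r mulr1 dfwith_in.
  by rewrite mulr0 dfwith_out // eq_sym.
rewrite lo_mul_idem lo_idem_mul /=.
case: (eqVneq e' i) => [->|_]; last by rewrite scale0r.
case: (eqVneq e i) => [->|_]; last by rewrite scale0r scaler0.
by rewrite lo_supp ?scaler0 // ltnn.
Qed.

Lemma lo_inM (j i : 'I_n) (x : M j i) j' i' : lo (inM x : T) j' i' =
  if (i' < j')%N then
    dfwith (fun j0 i0 => 0 : M j0 i0) (dfwith (fun i0 => 0 : M j i0) x) j' i'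
  else 0.
Proof. by []. Qed.

Lemma corner_off (j i : 'I_n) (y : T) (x : M j i) : (i < j)%N ->
  lo y j i = x -> idem j * y * idem i = inM x.
Proof.
move=> ij <-; apply: trimxP => [e|e e'].
  rewrite !dg_mul !dg_idem /=; case: (eqVneq e j) => [->|_]; last by rewrite !mul0r.
  rewrite (_ : (j == i) = false) ?mulr0 //.
  by apply: contraTF ij => /eqP ->; rewrite ltnn.
rewrite lo_mul_idem lo_idem_mul lo_inM.
case: ltnP => [lt|le]; last by rewrite lo_supp -?leqNgt // !scaler0.
case: (eqVneq e j) lt => [->|ne] lt; last first.
  by rewrite dfwith_out ?(eq_sym j) // scale0r scaler0.
rewrite dfwith_in scale1r; case: (eqVneq e' i) => [->|ne'].
  by rewrite dfwith_in scale1r.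
by rewrite dfwith_out ?(eq_sym i) // scale0r.
Qed.

Lemma inM_lo (j i : 'I_n) (x : T) : (i < j)%N ->
  inM (lo x j i) = idem j * x * idem i.
Proof. by move=> ij; rewrite (corner_off ij (erefl _)). Qed.

Lemma inM_tmu (j a i : 'I_n) (x y : T) : (i < a < j)%N ->
  inM (tmu (lo x j a) (lo y a i)) = idem j * (x * idem a * y) * idem i.
Proof.
move=> /[dup] lt /andP[ia aj]; rewrite (corner_off (ltn_trans ia aj) (erefl _)).
congr inM; rewrite -mulrA lo_mul dg_mul dg_idem lo_idem_mul.
have nj : (j == a) = false by apply: contraTF aj => /eqP ->; rewrite ltnn.
have ni : (i == a) = false by apply: contraTF ia => /eqP ->; rewrite ltnn.
rewrite ni nj scale0r lact0 mul0r act0r !add0r (bigD1 a) //.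
rewrite lo_idem_mul eqxx scale1r big1 => [|l /andP[lt' /negbTE nl]].
  by rewrite /= addr0.
by rewrite lo_idem_mul nl scale0r tmu0r.
Qed.

End Matrices.

(** * Sequences bordered on both sides *)

Section Sequences.
Context {T : nzRingType}.
Implicit Types (W : nat -> T) (a b i j : nat).

Definition upn W a x : nat -> T := fun b => if b == a then x else W b.

(** The border entries 1 make [hat f (pad z)] equal to [f z]. *)
Definition pad m (z : 'I_m -> T) : nat -> T :=
  fun a => if a is b.+1 then oapp z 1 (insub b) else 1.

Definition inner m W : 'I_m -> T := fun a : 'I_m => W a.+1.

Arguments inner m W : clear implicits.

Definition fuse i W : nat -> T :=
  fun b => if (b < i)%N then W b else
           if b == i then W i * W i.+1 else W b.+1.

Lemma upn_in W a x : upn W a x a = x.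
Proof. by rewrite /upn eqxx. Qed.

Lemma upn_out W a x b : b != a -> upn W a x b = W b.
Proof. by rewrite /upn => /negbTE ->. Qed.

Lemma upnn W a x y : upn (upn W a x) a y = upn W a y.
Proof. by apply: funext => b; rewrite /upn; case: eqP. Qed.

Lemma upn_id W a : upn W a (W a) = W.
Proof. by apply: funext => b; rewrite /upn; case: eqP => [->|]. Qed.

Lemma upnC W a b x y : a != b -> upn (upn W a x) b y = upn (upn W b y) a x.
Proof.
move=> ne; apply: funext => c; rewrite /upn.
by case: (eqVneq c b) => [->|//]; rewrite eq_sym (negbTE ne).
Qed.

Lemma pad_ord m (z : 'I_m -> T) (a : 'I_m) : pad z a.+1 = z a.
Proof. by rewrite /= valK. Qed.

Lemma pad_default m (z : 'I_m -> T) a : (m <= a)%N -> pad z a.+1 = 1.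
Proof. by move=> le; rewrite /= insubF // ltnNge le. Qed.

Lemma pad_inner m W a : (0 < a <= m)%N -> pad (inner m W) a = W a.
Proof. by case: a => // a am; rewrite -[a]/(val (Ordinal am)) pad_ord. Qed.

Lemma inner_pad m (z : 'I_m -> T) : inner m (pad z) = z.
Proof. by apply: funext => a; rewrite /inner pad_ord. Qed.

Lemma pad_inord m (z : 'I_m.+1 -> T) q : (q < m.+1)%N ->
  pad z q.+1 = z (inord q).
Proof. by move=> qm; rewrite -[RHS]pad_ord inordK. Qed.

Lemma inner_upn m W (a : 'I_m) x : inner m (upn W a.+1 x) = upd (inner m W) a x.
Proof. by apply: funext => b; rewrite /inner /upn /upd eqSS. Qed.

Lemma fuse_lt i W b : (b < i)%N -> fuse i W b = W b.
Proof. by rewrite /fuse => ->. Qed.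

Lemma fuse_eq i W : fuse i W i = W i * W i.+1.
Proof. by rewrite /fuse ltnn eqxx. Qed.

Lemma fuse_gt i W b : (i < b)%N -> fuse i W b = W b.+1.
Proof. by rewrite /fuse => lt; rewrite ltnNge ltnW // gtn_eqF. Qed.

Lemma fuse_upn_lt i W a x : (a < i)%N ->
  fuse i (upn W a x) = upn (fuse i W) a x.
Proof.
move=> ai; apply: funext => b; rewrite /upn.
case: (ltngtP b i) => [bi|bi|->].
- by rewrite !fuse_lt.
- rewrite !fuse_gt // !gtn_eqF //; first exact: ltn_trans bi.
  by rewrite ltnW // ltnS (ltn_trans ai).
by rewrite !fuse_eq !gtn_eqF //; rewrite ltnW.
Qed.

Lemma fuse_upn_eq i W x : fuse i (upn W i x) = upn (fuse i W) i (x * W i.+1).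
Proof.
apply: funext => b; rewrite /upn.
case: (ltngtP b i) => [bi|bi|->].
- by rewrite !fuse_lt // ltn_eqF.
- by rewrite !fuse_gt // gtn_eqF // ltnW.
by rewrite !fuse_eq eqxx gtn_eqF.
Qed.

Lemma fuse_upn_eqS i W x :
  fuse i (upn W i.+1 x) = upn (fuse i W) i (W i * x).
Proof.
apply: funext => b; rewrite /upn.
case: (ltngtP b i) => [bi|bi|->].
- by rewrite !fuse_lt // ltn_eqF // ltnW.
- by rewrite !fuse_gt // eqSS gtn_eqF.
by rewrite !fuse_eq eqxx ltn_eqF.
Qed.

Lemma fuse_upn_gt i W a x : (i < a)%N ->
  fuse i (upn W a.+1 x) = upn (fuse i W) a x.
Proof.
move=> ia; apply: funext => b; rewrite /upn.
case: (ltngtP b i) => [bi|bi|->].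
- rewrite !fuse_lt // !ltn_eqF //; first exact: ltn_trans ia.
  by rewrite ltnS ltnW // (ltn_trans bi).
- by rewrite !fuse_gt // eqSS.
by rewrite !fuse_eq !ltn_eqF // ltnS // ltnW.
Qed.

(** The identities between faces; for i = j this is associativity in T. *)
Lemma fuse_fuse i j W : (i <= j)%N ->
  fuse j (fuse i W) = fuse i (fuse j.+1 W).
Proof.
move=> ij; apply: funext => b.
case: (ltngtP b j) => [bj|bj|->].
- rewrite (fuse_lt _ bj); case: (ltngtP b i) => [bi|bi|eb].
  + by rewrite !fuse_lt // ltnW.
  + by rewrite !(fuse_gt _ bi) fuse_lt.
  + by rewrite eb in bj *; rewrite !fuse_eq !fuse_lt // ltnW.
- have ib := leq_ltn_trans ij bj.
  rewrite (fuse_gt _ bj) (fuse_gt _ ib) (fuse_gt _ (ltnW ib : i < b.+1)%N).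
  by rewrite (fuse_gt _ (bj : j.+1 < b.+1)%N).
rewrite fuse_eq; case: (ltngtP i j) ij => // [ij|->] _.
  by rewrite !(fuse_gt _ ij) fuse_eq fuse_gt // ltnW.
by rewrite !fuse_eq (fuse_lt _ (ltnSn j)) (fuse_gt _ (ltnSn j)) mulrA.
Qed.

End Sequences.

Arguments inner {T} m W _.

(** * Faces and the coboundary *)

Section Hat.
Context {k : fieldType} {n : nat} {D : triangular k n}.
Local Notation T := (trimx D).
Section Coef.
Variable X : bimod T T.
Implicit Types (W : nat -> T) (a b i j m : nat).

Definition hat m (f : cochain X m) W : X :=
  ract (lact (W 0%N) (f (inner m W))) (W m.+1).

Definition face m i (f : cochain X m) : cochain X m.+1 :=
  fun z => hat f (fuse i (pad z)).

Lemma eq_hat m (f : cochain X m) W W' :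
  (forall a, (a <= m.+1)%N -> W a = W' a) -> hat f W = hat f W'.
Proof.
move=> e; rewrite /hat !e //; congr (ract (lact _ (f _)) _).
by apply: funext => a; rewrite /inner e // ltnS ltnW.
Qed.

Lemma hat_pad m (f : cochain X m) z : hat f (pad z) = f z.
Proof. by rewrite /hat inner_pad pad_default //= lact1 ract1. Qed.

Lemma hat_ends m (f : cochain X m) W x y :
  ract (lact x (hat f W)) y =
  hat f (upn (upn W 0 (x * W 0%N)) m.+1 (W m.+1 * y)).
Proof.
rewrite /hat upn_in (upn_out _ _ (isT : 0%N != m.+1)) upn_in.
rewrite lactM ractM -!lractA; congr (ract (ract (lact _ (lact _ (f _))) _) _).
by apply: funext => a; rewrite /inner upn_out ?upn_out // eqSS ltn_eqF.
Qed.

(** With the borders included, all m+2 faces have the same shape, the border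
    entries being moved in and out by the module axioms of X. *)
Lemma hat_face m i (f : cochain X m) W : (i <= m.+1)%N ->
  hat (face i f) W = hat f (fuse i W).
Proof.
move=> im; rewrite {1}/hat /face hat_ends; apply: eq_hat => a am.
rewrite /upn; case: (eqVneq a m.+1) => [->|ne].
  case: (ltngtP i m.+1) im => // [im|->] _.
    by rewrite !fuse_gt // pad_default // mul1r.
  by rewrite !fuse_eq pad_inner ?leqnn // pad_default // mulr1.
case: (eqVneq a 0%N) => [->|nea].
  case: i im => [|i] im.
    by rewrite !fuse_eq -[pad _ 0]/1 mul1r pad_inner.
  by rewrite !fuse_lt //= mulr1.
have lt: (a < m.+1)%N by rewrite ltn_neqAle ne.
have a0: (0 < a)%N by rewrite lt0n.
case: (ltngtP a i) => [ai|ai|ea].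
- by rewrite !fuse_lt // pad_inner ?a0 // ltnW.
- by rewrite !fuse_gt // pad_inner.
by rewrite -ea !fuse_eq !pad_inner // ?a0 // ltnW.
Qed.

Lemma delta_face m (f : cochain X m) z :
  delta f z = \sum_(i < m.+2) (-1) ^+ i *: face i f z.
Proof.
rewrite /delta big_ord_recl big_ord_recr /= addrA; congr (_ + _ + _).
- rewrite expr0 scale1r /face /hat fuse_eq fuse_gt //.
  rewrite (pad_default z (leqnn _)) ract1 mul1r -(pad_ord z ord0).
  congr (lact _ (f _)).
  by apply: funext => a; rewrite /inner fuse_gt // -(pad_ord z).
- apply: eq_bigr => i _; rewrite /bump /= add1n; congr (_ *: _).
  rewrite /face /hat fuse_lt // lact1 fuse_gt ?ltnS // (pad_default z (leqnn _)) ract1.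
  congr (f _); apply: funext => a; rewrite /inner /contract.
  case: ltngtP => [ai|ai|ai].
  + by rewrite fuse_lt ?ltnS // -(pad_ord z).
  + by rewrite fuse_gt ?ltnS // -(pad_ord z).
  + by rewrite -[a.+1]/(a.+1) ai fuse_eq -!(pad_ord z).
- rewrite /bump /= add1n; congr (_ *: _); rewrite /face /hat fuse_lt // lact1.
  rewrite fuse_eq (pad_default z (leqnn _)) mulr1 -(pad_ord z); congr (ract (f _) _).
  by apply: funext => a; rewrite /inner fuse_lt ?ltnS // -(pad_ord z).
Qed.

End Coef.
End Hat.

(** The combinatorial half of delta o delta = 0: the index pairs with i <= j are
    matched with the remaining ones by (i, j) |-> (j+1, i). *)
Lemma simplicial_cancel (V : zmodType) N (a : nat -> nat -> V) :
  (forall i j, (i <= j < N)%N -> a i j = - a j.+1 i) ->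
  \sum_(i < N.+1) \sum_(j < N) a i j = 0.
Proof.
move=> anti; under eq_bigr => i _ do rewrite (bigID (fun j : 'I_N => (i <= j)%N)) /=.
rewrite big_split /= (exchange_big_dep predT) //=.
have -> : \sum_(j < N) \sum_(i < N.+1 | (i <= j)%N) a i j =
    - \sum_(j < N) \sum_(i < N | (i <= j)%N) a j.+1 i.
  rewrite -sumrN; apply: eq_bigr => j _; rewrite -sumrN big_mkcond big_ord_recr /=.
  rewrite [X in if X then _ else _]leqNgt ltn_ord addr0 -big_mkcond /=.
  by apply: eq_bigr => i ij; rewrite anti // ij ltn_ord.
rewrite [X in _ + X]big_ord_recl [X in _ + (X + _)]big_pred0 // add0r.
rewrite /=; under [X in _ + X]eq_bigr => j _ do
  under eq_bigl => i do rewrite /bump /= add1n -ltnNge ltnS.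
by rewrite addNr.
Qed.

Section Cochains.
Context {k : fieldType} {n : nat} {D : triangular k n}.
Local Notation T := (trimx D).
Section Coef.
Variable X : bimod T T.
Implicit Types (W : nat -> T) (a b i j m : nat).

Lemma hatD m (f g : cochain X m) W : hat (f + g) W = hat f W + hat g W.
Proof. by rewrite /hat -ractD -lactD. Qed.

Lemma hatZ m c (f : cochain X m) W : hat (c *: f) W = c *: hat f W.
Proof. by rewrite /hat -ractZ -lactZ. Qed.

Lemma hat0 m W : hat (0 : cochain X m) W = 0.
Proof. by rewrite /hat lact0 ract0. Qed.

Lemma hat_sum m (I : Type) (r : seq I) (P : pred I) (F : I -> cochain X m) W :
  hat (\sum_(i <- r | P i) F i) W = \sum_(i <- r | P i) hat (F i) W.
Proof.
exact: (big_morph (fun f : cochain X m => hat f W)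
          (fun f g => hatD f g W) (hat0 m W)).
Qed.

Lemma cochain_sumE m (I : Type) (r : seq I) (P : pred I) (F : I -> cochain X m) z :
  (\sum_(i <- r | P i) F i) z = \sum_(i <- r | P i) F i z.
Proof.
by apply: (big_rec2 (fun (g : cochain X m) x => g z = x)) => // i g x _ <-.
Qed.

Lemma delta_sum_face m (f : cochain X m) :
  delta f = \sum_(i < m.+2) (-1) ^+ i *: face i f.
Proof. by apply: funext => z; rewrite delta_face cochain_sumE. Qed.

Lemma hat_delta m (f : cochain X m) W :
  hat (delta f) W = \sum_(i < m.+2) (-1) ^+ i *: hat f (fuse i W).
Proof.
rewrite delta_sum_face hat_sum; apply: eq_bigr => i _.
by rewrite hatZ hat_face // -ltnS.
Qed.

Lemma cochain_eq m (f g : cochain X m) : (forall W, hat f W = hat g W) -> f = g.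
Proof. by move=> e; apply: funext => z; rewrite -!hat_pad. Qed.

Lemma deltaK m (f : cochain X m) : delta (delta f) = 0.
Proof.
apply: cochain_eq => W; rewrite hat_delta hat0.
under eq_bigr => i _ do rewrite hat_delta scaler_sumr.
apply: (simplicial_cancel
  (a := fun i j => (-1) ^+ i *: ((-1) ^+ j *: hat f (fuse j (fuse i W))))).
move=> i j /andP[ij _]; rewrite !scalerA -!exprD (fuse_fuse _ ij).
by rewrite addSn exprS mulN1r scaleNr opprK addnC.
Qed.

Lemma deltaD m (f g : cochain X m) : delta (f + g) = delta f + delta g.
Proof.
apply: cochain_eq => W; rewrite hatD !hat_delta -big_split /=.
by apply: eq_bigr => i _; rewrite hatD scalerDr.
Qed.

Lemma deltaZ m c (f : cochain X m) : delta (c *: f) = c *: delta f.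
Proof.
apply: cochain_eq => W; rewrite hatZ !hat_delta scaler_sumr /=.
by apply: eq_bigr => i _; rewrite hatZ !scalerA mulrC.
Qed.

(** * Cochains over R as balanced multilinear maps *)

Definition hat_linear m (f : cochain X m) :=
  forall W a (c : k) x y, (a <= m.+1)%N ->
  hat f (upn W a (c *: x + y)) = c *: hat f (upn W a x) + hat f (upn W a y).

(** Being a morphism of R-bimodules on the tensor power over R, in a single
    condition: the joints 0 and m express R-linearity on the left and on the
    right, for m = 0 both joints coincide and say that the value commutes with
    R. Idempotents suffice since they span R ([hat_balanced_subR]). *)
Definition hat_balanced m (f : cochain X m) := forall W a e, (a <= m)%N ->
  hat f (upn W a (W a * idem e)) = hat f (upn W a.+1 (idem e * W a.+1)).

Lemma hat_upn_first m (f : cochain X m) W x :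
  hat f (upn W 0 x) = ract (lact x (f (inner m W))) (W m.+1).
Proof. by rewrite /hat upn_in upn_out. Qed.

Lemma hat_upn_last m (f : cochain X m) W x :
  hat f (upn W m.+1 x) = ract (lact (W 0%N) (f (inner m W))) x.
Proof.
rewrite /hat upn_in upn_out //; congr (ract (lact _ (f _)) _).
by apply: funext => a; rewrite /inner upn_out // eqSS ltn_eqF.
Qed.

Lemma hat_upn_mid m (f : cochain X m) W (a : 'I_m) x : hat f (upn W a.+1 x) =
  ract (lact (W 0%N) (f (upd (inner m W) a x))) (W m.+1).
Proof.
by rewrite /hat inner_upn !upn_out // eqSS gtn_eqF.
Qed.

Lemma index_cases m a : (a <= m.+1)%N ->
  [\/ a = 0%N, a = m.+1 | exists b : 'I_m, a = b.+1].
Proof.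
case: a => [|a]; first by constructor 1.
rewrite ltnS leq_eqVlt => /orP[/eqP ->|am]; first by constructor 2.
by constructor 3; exists (Ordinal am).
Qed.

Lemma multilinear_hat m (f : cochain X m) : multilinear f -> hat_linear f.
Proof.
move=> mf W a c x y /index_cases[->|->|[b ->]].
- by rewrite !hat_upn_first lact_linl ract_linl.
- by rewrite !hat_upn_last ract_linr.
by rewrite !hat_upn_mid mf lact_linr ract_linl.
Qed.

Lemma hat_multilinear m (f : cochain X m) : hat_linear f -> multilinear f.
Proof.
move=> hf z a c x y; have am : (a.+1 <= m.+1)%N by rewrite ltnS ltnW.
have := hf (pad z) a.+1 c x y am; rewrite !hat_upn_mid !inner_pad.
by rewrite (pad_default z (leqnn _)) !lact1 !ract1.
Qed.

Lemma hat_upn0 m (f : cochain X m) W a : hat_linear f -> (a <= m.+1)%N ->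
  hat f (upn W a 0) = 0.
Proof.
move=> hf am; have := hf W a 1 0 0 am.
by rewrite !scale1r addr0 => /add_idem.
Qed.

Lemma hat_zero m (f : cochain X m) W a : hat_linear f -> (a <= m.+1)%N ->
  W a = 0 -> hat f W = 0.
Proof. by move=> hf am W0; rewrite -(upn_id W a) W0 hat_upn0. Qed.

Lemma subR_idem e : subR (idem e : T).
Proof.
exists (fun i : 'I_n => (i == e)%:R);
rewrite (bigD1 e) //= eqxx scale1r big1 ?addr0 //.
by move=> i /negbTE ->; rewrite scale0r.
Qed.

Lemma Hcochain_balanced m (f : cochain X m) : Hcochain f -> hat_balanced f.
Proof.
case=> mf bal left right zero W a e am; have re := subR_idem e.
case: (index_cases (leqW am)) => [a0|a0|[b eb]].
- rewrite {}a0 in am *.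
  case: m f mf bal left right zero am => [|m] f mf bal left right zero _.
    rewrite hat_upn_first hat_upn_last lactM ractM zero //.
    by rewrite -lractA.
  rewrite hat_upn_first (hat_upn_mid f W ord0) lactM.
  by rewrite -[W 1%N]/(inner m.+1 W ord0) (left _ ord0 _ re).
- by rewrite a0 ltnn in am.
rewrite {}eb in am *; rewrite hat_upn_mid.
move: (am); rewrite leq_eqVlt => /orP[/eqP ebm|bm].
  rewrite {2}ebm hat_upn_last ractM -[W b.+1]/(inner m W b) (right _ _ _ re ebm).
  by rewrite -lractA; congr (ract _ (W _)); rewrite ebm.
rewrite (hat_upn_mid f W (Ordinal bm)) -[W b.+1]/(inner m W b).
by rewrite (bal _ b (Ordinal bm) _ re).
Qed.

Lemma hat_upn_sum m (f : cochain X m) W a (c : 'I_n -> k) (x : 'I_n -> T) :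
  hat_linear f -> (a <= m.+1)%N ->
  hat f (upn W a (\sum_i c i *: x i)) = \sum_i c i *: hat f (upn W a (x i)).
Proof.
move=> hf am.
apply: (big_rec2 (fun x y => hat f (upn W a x) = y)); first exact: hat_upn0.
by move=> i y x' _ <-; rewrite hf.
Qed.

Lemma hat_balanced_subR m (f : cochain X m) W a r :
  hat_linear f -> hat_balanced f -> subR r -> (a <= m)%N ->
  hat f (upn W a (W a * r)) = hat f (upn W a.+1 (r * W a.+1)).
Proof.
move=> hf hb [c ->] am.
rewrite mulr_sumr mulr_suml.
under eq_bigr => i _ do rewrite -scalerAr.
under [in RHS]eq_bigr => i _ do rewrite -scalerAl.
rewrite !hat_upn_sum // 1?ltnW //.
by apply: eq_bigr => i _; rewrite hb.
Qed.

Lemma hat_pad_upn m (f : cochain X m) z (a : 'I_m) x :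
  hat f (upn (pad z) a.+1 x) = f (upd z a x).
Proof. by rewrite hat_upn_mid inner_pad (pad_default z (leqnn _)) lact1 ract1. Qed.

Lemma hat_pad_first m (f : cochain X m) z x :
  hat f (upn (pad z) 0 x) = lact x (f z).
Proof. by rewrite hat_upn_first inner_pad (pad_default z (leqnn _)) ract1. Qed.

Lemma hat_pad_last m (f : cochain X m) z x :
  hat f (upn (pad z) m.+1 x) = ract (f z) x.
Proof. by rewrite hat_upn_last inner_pad lact1. Qed.

Lemma balanced_Hcochain m (f : cochain X m) :
  hat_linear f -> hat_balanced f -> Hcochain f.
Proof.
move=> hf hb; have bal (z : 'I_m -> T) a r : subR r -> (a <= m)%N ->
  hat f (upn (pad z) a (pad z a * r)) = hat f (upn (pad z) a.+1 (r * pad z a.+1)).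
  exact: hat_balanced_subR.
split; first exact: hat_multilinear.
- move=> z a b r rR eb; have := bal z a.+1 r rR (ltn_ord a).
  by rewrite hat_pad_upn pad_ord -!eb hat_pad_upn pad_ord.
- move=> z a r rR a0; have := bal z 0%N r rR isT.
  by rewrite hat_pad_first -[pad z 0]/1 mul1r => ->; rewrite -a0 hat_pad_upn pad_ord.
- move=> z a r rR am; have := bal z a.+1 r rR (ltn_ord a).
  rewrite hat_pad_upn pad_ord => ->.
  by rewrite am hat_pad_last (pad_default z (leqnn _)) mulr1.
- move=> z r rR m0; have := bal z 0%N r rR isT.
  rewrite hat_pad_first -[pad z 0]/1 mul1r => ->; move: f hf hb bal z.
  rewrite m0 => f _ _ _ z.
  by rewrite hat_pad_last (pad_default z (leqnn _)) mulr1.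
Qed.

Lemma Hcochain_linear m (f : cochain X m) : Hcochain f -> hat_linear f.
Proof. by case=> mf *; exact: multilinear_hat. Qed.

Lemma Hcochain_lin m c (f g : cochain X m) :
  Hcochain f -> Hcochain g -> Hcochain (c *: f + g).
Proof.
move=> Hf Hg; apply: balanced_Hcochain.
  move=> W a d x y am; rewrite !hatD !hatZ !Hcochain_linear // !scalerDr.
  by rewrite !scalerA (mulrC c d) addrACA.
by move=> W a e am; rewrite !hatD !hatZ !Hcochain_balanced.
Qed.

Lemma face_linear m i (f : cochain X m) : (i <= m.+1)%N ->
  hat_linear f -> hat_linear (face i f).
Proof.
move=> im hf W a c x y am; rewrite !hat_face //.
case: (ltngtP a i) => [ai|ai|->].
- by rewrite !fuse_upn_lt // hf // (leq_trans (ltnW ai)).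
- case: a ai am => // a; rewrite ltnS leq_eqVlt => /orP[/eqP ->|ia] am.
    by rewrite !fuse_upn_eqS mulrDr -scalerAr hf.
  by rewrite !fuse_upn_gt // hf.
by rewrite !fuse_upn_eq mulrDl -scalerAl hf.
Qed.

Lemma face_balanced m i (f : cochain X m) : (i <= m.+1)%N ->
  hat_balanced f -> hat_balanced (face i f).
Proof.
move=> im hb W a e am; rewrite !hat_face //.
case: (ltngtP a.+1 i) => [ai|ai|ai].
- rewrite !fuse_upn_lt // ?(ltnW ai) //.
  rewrite -(fuse_lt W (ltnW ai)) -(fuse_lt W ai) hb //.
  by rewrite -ltnS ltnW // (leq_trans ai).
- rewrite ltnS leq_eqVlt in ai; case/orP: ai => [/eqP ->|ia].
    by rewrite fuse_upn_eq fuse_upn_eqS mulrA.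
  case: a ia am => // a; rewrite ltnS leq_eqVlt => /orP[/eqP ->|ia] am.
    rewrite fuse_upn_eqS fuse_upn_gt // mulrA -fuse_eq -(fuse_gt W (ltnSn a)).
    exact: hb.
  rewrite !fuse_upn_gt // 1?ltnW //.
  by rewrite -(fuse_gt W ia) -(fuse_gt W (ltnW ia : i < a.+1)%N) hb.
rewrite -ai in im *; rewrite fuse_upn_lt // fuse_upn_eq.
by rewrite -mulrA -fuse_eq -(fuse_lt W (ltnSn a)) hb.
Qed.

Lemma face_Hcochain m i (f : cochain X m) : (i <= m.+1)%N ->
  Hcochain f -> Hcochain (face i f).
Proof.
move=> im Hf; apply: balanced_Hcochain.
  exact: face_linear (Hcochain_linear Hf).
exact: face_balanced (Hcochain_balanced Hf).
Qed.

Lemma Hcochain0 m : Hcochain (0 : cochain X m).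
Proof.
by apply: balanced_Hcochain => W a *; rewrite !hat0 ?scaler0 ?addr0.
Qed.

Lemma Hcochain_sum m (I : Type) (r : seq I) (P : pred I) (F : I -> cochain X m) :
  (forall u, P u -> Hcochain (F u)) -> Hcochain (\sum_(i <- r | P i) F i).
Proof.
move=> HF; elim/big_rec: _ => [|u f Pu Hf]; first exact: Hcochain0.
by rewrite -[F u]scale1r; apply: Hcochain_lin => //; exact: HF.
Qed.

Lemma HcochainZ m c (f : cochain X m) : Hcochain f -> Hcochain (c *: f).
Proof. by move=> Hf; rewrite -[_ *: _]addr0; apply: Hcochain_lin (Hcochain0 _). Qed.

Lemma delta_Hcochain m (f : cochain X m) : Hcochain f -> Hcochain (delta f).
Proof.
move=> Hf; rewrite delta_sum_face; apply: Hcochain_sum => i _.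
by apply/HcochainZ/face_Hcochain => //; rewrite -ltnS.
Qed.

(** The restriction of f to the tensors whose i-th vertex is e, extended by zero
    to the others. *)
Definition cut m i e (f : cochain X m) : cochain X m :=
  fun z => hat f (upn (pad z) i (pad z i * idem e)).

Lemma hat_cut m i e (f : cochain X m) W : (i <= m)%N ->
  hat (cut i e f) W = hat f (upn W i (W i * idem e)).
Proof.
move=> im; rewrite {1}/hat /cut hat_ends; apply: eq_hat => a am; rewrite /upn.
case: (eqVneq a m.+1) => [->|ne].
  by rewrite gtn_eqF ?ltnS // (pad_default _ (leqnn _)) mul1r.
have am' : (a <= m)%N by rewrite -ltnS ltn_neqAle ne.
case: (eqVneq a 0%N) => [->|a0].
  by case: eqP => [<-|_]; rewrite ?mul1r ?mulr1.
have ain : (0 < a <= m)%N by rewrite lt0n a0.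
rewrite (pad_inner _ ain); case: (eqVneq a i) => // <-.
by rewrite (pad_inner _ ain).
Qed.

Lemma idem_comm e e' : (idem e : T) * idem e' = idem e' * idem e.
Proof.
by case: (eqVneq e e') => [->//|ne]; rewrite !idem_mul (eq_sym e') (negbTE ne).
Qed.

(** Cutting preserves balancedness because R is commutative. *)
Lemma cut_Hcochain m i e (f : cochain X m) : (i <= m)%N ->
  Hcochain f -> Hcochain (cut i e f).
Proof.
move=> im Hf; have hf := Hcochain_linear Hf; have hb := Hcochain_balanced Hf.
apply: balanced_Hcochain => [W a c x y am|W a e' am]; rewrite !hat_cut //.
  case: (eqVneq a i) => [->|ne].
    by rewrite !upn_in !upnn mulrDl -scalerAl hf // -ltnS ltnW.
  by rewrite !(upn_out _ _ (_ : i != a)) ?(eq_sym i) // !(upnC _ _ _ ne) hf.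
case: (eqVneq a i) => [ai|ne].
  rewrite -ai !upn_in upnn upn_out ?neq_ltn ?ltnSn // upnC ?neq_ltn ?ltnSn ?orbT //.
  rewrite -[W a.+1](upn_out W (W a * idem e) (b := a.+1) (a := a))
    ?neq_ltn ?ltnSn ?orbT //.
  by rewrite -hb // upn_in upnn -!mulrA (idem_comm e).
rewrite [upn W a _ i]upn_out 1?eq_sym // upnC //.
rewrite -{1}[W a](upn_out W (W i * idem e) ne) hb //.
case: (eqVneq a.+1 i) => [ai|ne'].
  by rewrite ai !upn_in !upnn mulrA.
rewrite (upn_out _ _ ne') (upn_out _ _ (_ : i != a.+1)) 1?eq_sym //.
by rewrite upnC // eq_sym.
Qed.
End Coef.
End Cochains.

(** * Trajectories and the filtration *)

Section Trajectories.
Variable n : nat.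
Implicit Types (v w : nat -> 'I_n) (m i : nat).

Definition del_vertex i v : nat -> 'I_n :=
  fun a => if (a < i)%N then v a else v a.+1.

(** Vertex e can be inserted before index i of w so that the length grows: it has
    to differ from both neighbours, of which the first and the last place have
    only one. *)
Definition insertable m i w (e : 'I_n) : bool :=
  ((i == 0%N) || (e < w i.-1)%N) && ((i == m.+1) || (w i < e)%N).

Lemma traj_lenS m v :
  traj_len m.+1 v = ((v 0 != v 1)%N + traj_len m (fun a => v a.+1))%N.
Proof. by rewrite /traj_len big_ord_recl. Qed.

Lemma traj_neq_lt (x y : 'I_n) : (x <= y)%N -> (y != x) = (x < y)%N.
Proof. by move=> xy; rewrite ltn_neqAle xy andbT eq_sym. Qed.

(** Monotonicity makes the count exact: v_(i-1) >= v_i >= v_(i+1) takes two steps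
    instead of one precisely when both inequalities are strict. *)
Lemma traj_len_del_vertex m i v : trajectory m.+1 v -> (i <= m.+1)%N ->
  traj_len m.+1 v =
    (traj_len m (del_vertex i v) + insertable m i (del_vertex i v) (v i))%N.
Proof.
elim: i m v => [|i IHi] m v tv im.
  rewrite traj_lenS traj_neq_lt ?tv // addnC; congr (_ + _)%N.
case: m => [|m] in tv im *.
  case: i IHi im => // _ _.
  rewrite traj_lenS /traj_len !big_ord0 addn0 traj_neq_lt ?tv //.
  by rewrite /insertable /del_vertex /= andbT.
have tv' : trajectory m.+1 (fun a => v a.+1) by move=> a am; exact: tv.
rewrite traj_lenS; case: i IHi im => [|i] IHi im; last first.
  rewrite (IHi m (fun a => v a.+1)) // addnA; congr (_ + _)%N.
  by rewrite traj_lenS.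
rewrite !traj_lenS addnA [RHS]addnAC; congr (_ + _)%N.
have t01 : (v 1 <= v 0)%N by exact: tv.
have t12 : (v 2 <= v 1)%N by exact: tv.
rewrite /insertable /del_vertex /=.
rewrite !traj_neq_lt //; last exact: leq_trans t01.
case: (ltngtP (v 1) (v 0)) t01 => // [lt|e] _;
  case: (ltngtP (v 2) (v 1)) t12 => // [lt'|e'] _.
- by rewrite (ltn_trans lt' lt).
- by rewrite e' lt.
- by rewrite -e lt'.
by rewrite e' e ltnn.
Qed.

Lemma trajectory_del_vertex m i v :
  trajectory m.+1 v -> trajectory m (del_vertex i v).
Proof.
move=> tv a am; rewrite /del_vertex; case: (ltngtP a.+1 i) => [lt|lt|eai].
- by rewrite tv // ltnS ltnW.
- by rewrite tv.
- by rewrite (leq_trans (tv a.+1 _)) // tv // ltnS ltnW.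
Qed.

Lemma eq_traj_len m v w : (forall a, (a <= m)%N -> v a = w a) ->
  traj_len m v = traj_len m w.
Proof.
by move=> e; apply: eq_bigr => a _; rewrite !e // ltnW.
Qed.

Lemma eq_insertable m i v w e : (i <= m.+1)%N ->
  (forall a, (a <= m)%N -> v a = w a) ->
  insertable m i v e = insertable m i w e.
Proof.
move=> im ev; rewrite /insertable; congr (_ && _).
  by case: i im => // i im; rewrite ev.
by case: (eqVneq i m.+1) => //= ne; rewrite ev // -ltnS ltn_neqAle ne.
Qed.

End Trajectories.

Section Filtration.
Context {k : fieldType} {n : nat} {D : triangular k n}.
Local Notation T := (trimx D).
Section Coef.
Variable X : bimod T T.
Implicit Types (W : nat -> T) (v w : nat -> 'I_n) (a b i j m : nat).

(** One idempotent per joint is enough to impose a trajectory, as a balanced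
    cochain lets it act on both sides of the joint ([hat_rmul]). *)
Definition rmul m v W : nat -> T :=
  fun a => if (a <= m)%N then W a * idem (v a) else W a.

Lemma rmul_le m v W a : (a <= m)%N -> rmul m v W a = W a * idem (v a).
Proof. by rewrite /rmul => ->. Qed.

Lemma rmul_idem m v W a e : (a <= m)%N ->
  rmul m v W a * idem e = if v a == e then rmul m v W a else 0.
Proof.
by move=> am; rewrite rmul_le // -mulrA idem_mul; case: eqP; rewrite ?mulr0.
Qed.

Lemma hat_rmul m (f : cochain X m) v W : Hcochain f ->
  hat f (rmul m v W) =
  ract (lact (W 0%N) (lact (idem (v 0%N)) (f (tproj v (inner m W))))) (W m.+1).
Proof.
move=> Hf; have hb := Hcochain_balanced Hf.
(* The idempotents are moved across the joints one at a time, from the left. *)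
pose lr b a := if (0 < a <= b)%N then idem (v a.-1) * rmul m v W a else rmul m v W a.
have lrE b : (b <= m)%N -> hat f (rmul m v W) = hat f (lr b).
  elim: b => [_|b IHb bm].
    by apply: eq_hat => a _; rewrite /lr leqn0; case: a.
  rewrite IHb ?(ltnW bm) // -{1}(upn_id (lr b) b).
  have -> : lr b b = lr b b * idem (v b).
    rewrite /lr; case: ifP => _; rewrite ?[in RHS]mulrA -?mulrA rmul_idem ?eqxx //;
      exact: ltnW.
  rewrite hb ?(ltnW bm) //; apply: eq_hat => a _; rewrite /upn /lr.
  case: (ltngtP a b.+1) => [ab|ab|->]; rewrite ?ltnn ?andbF //=.
    by rewrite -[(a <= b)%N]/(a < b.+1)%N ab.
  by rewrite (leqNgt a b) (ltn_trans (ltnSn b) ab) andbF.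
rewrite (lrE m) // /hat.
have -> : lr m 0%N = W 0%N * idem (v 0%N) by rewrite /lr rmul_le.
have -> : lr m m.+1 = W m.+1 by rewrite /lr ltnn andbF /rmul ltnn.
have -> : inner m (lr m) = tproj v (inner m W).
  apply: funext => a; rewrite /inner /tproj /lr (ltn_ord a) rmul_le //.
  exact: mulrA.
by rewrite lactM.
Qed.

Lemma vanishes_onP m (f : cochain X m) v : Hcochain f ->
  vanishes_on v f <-> forall W, hat f (rmul m v W) = 0.
Proof.
move=> Hf; split=> [vf W|hf z].
  by rewrite hat_rmul // vf lact0 ract0.
have := hf (pad z).
by rewrite hat_rmul // inner_pad (pad_default z (leqnn _)) ract1 lact1.
Qed.

(** The i-th face drops vertex i of the trajectory, whose idempotent remains as a
    mere factor between the two fused entries. *)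
Lemma hat_face_rmul m i (f : cochain X m) v W : (i <= m.+1)%N ->
  hat (face i f) (rmul m.+1 v W) =
  hat f (rmul m (del_vertex i v) (fuse i (upn W i (W i * idem (v i))))).
Proof.
move=> im; rewrite hat_face //; apply: eq_hat => a am; rewrite /rmul /del_vertex.
case: (ltngtP a i) => [ai|ai|->].
- rewrite !fuse_lt // upn_out ?ltn_eqF // am.
  by rewrite -ltnS (leq_trans ai).
- by rewrite !fuse_gt // upn_out ?gtn_eqF // ltnS // ltnW.
rewrite !fuse_eq im ltnS upn_in upn_out ?gtn_eqF //.
by case: ifP; rewrite ?mulrA.
Qed.

Lemma FiltP t m (f : cochain X m) : Filt t f <-> Hcochain f /\
  forall v, trajectory m v -> (traj_len m v < t)%N ->
  forall W, hat f (rmul m v W) = 0.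
Proof.
split=> -[Hf vf]; split=> // v tv lv; first by apply/vanishes_onP; auto.
by apply/vanishes_onP => // W; exact: vf.
Qed.

Lemma Filt_lin t m c (f g : cochain X m) :
  Filt t f -> Filt t g -> Filt t (c *: f + g).
Proof.
move=> /FiltP[Hf vf] /FiltP[Hg vg]; apply/FiltP; split.
  exact: Hcochain_lin.
by move=> v tv lv W; rewrite hatD hatZ vf // vg // scaler0 addr0.
Qed.

Lemma Filt0 t m : Filt t (0 : cochain X m).
Proof. by apply/FiltP; split=> [|*]; [exact: Hcochain0 | rewrite hat0]. Qed.

Lemma FiltW t t' m (f : cochain X m) : (t' <= t)%N -> Filt t f -> Filt t' f.
Proof.
move=> le [Hf vf]; split=> // v tv lv; apply: vf => //; exact: leq_trans le.
Qed.

(** Removing a vertex never lengthens a trajectory. *)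
Lemma Filt_delta t m (f : cochain X m) : Filt t f -> Filt t (delta f).
Proof.
move=> /FiltP[Hf vf]; apply/FiltP; split; first exact: delta_Hcochain.
move=> v tv lv W; rewrite delta_sum_face hat_sum big1 // => i _.
have im : (i <= m.+1)%N by rewrite -ltnS.
rewrite hatZ hat_face_rmul // vf ?scaler0 //; first exact: trajectory_del_vertex.
by apply: leq_ltn_trans lv; rewrite (traj_len_del_vertex tv im) leq_addr.
Qed.

(** For m = 0 the defining condition of [summand] is empty, whence 0 < m. *)
Lemma summand_absorb m (f : cochain X m) v W : (0 < m)%N ->
  summand v f -> hat f W = hat f (rmul m v W).
Proof.
case: m f => // m f _ [Hf fv]; rewrite hat_rmul // /hat fv.
congr (ract (lact _ _) _); case: Hf => _ _ left _ _.
rewrite -(left _ ord0 _ (subR_idem _)) //; congr f; apply: funext => a.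
rewrite /upd; case: eqP => // ->.
by rewrite /tproj !mulrA idemK.
Qed.

Lemma summand_right m (f : cochain X m) v W i : (0 < m)%N -> (i <= m)%N ->
  summand v f -> hat f (upn W i (W i * idem (v i))) = hat f W.
Proof.
move=> m0 im fv.
rewrite [LHS](summand_absorb _ m0 fv) [RHS](summand_absorb _ m0 fv).
apply: eq_hat => a _.
rewrite /rmul /upn; case: (eqVneq a i) => // ->.
by rewrite im -mulrA idemK.
Qed.

Lemma summand_left m (f : cochain X m) v W i : (0 < m)%N -> (i <= m)%N ->
  summand v f -> hat f (upn W i.+1 (idem (v i) * W i.+1)) = hat f W.
Proof.
move=> m0 im fv; case: (fv) => Hf _.
by rewrite -Hcochain_balanced // summand_right.
Qed.

(** Orthogonality of the idempotents: a summand only sees its own trajectory. *)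
Lemma summand_support m (f : cochain X m) v w W : (0 < m)%N ->
  summand w f -> hat f (rmul m v W) != 0 ->
  forall a, (a <= m)%N -> v a = w a.
Proof.
move=> m0 fw nz a am; apply: contra_neqP nz => ne.
rewrite (summand_absorb _ m0 fw).
case: fw => Hf _; apply: (hat_zero (a := a) (Hcochain_linear Hf)).
  exact: leqW.
by rewrite rmul_le // rmul_idem // (introF eqP ne).
Qed.

Lemma summand_Filt m (f : cochain X m) w : (0 < m)%N -> summand w f ->
  Filt (traj_len m w) f.
Proof.
move=> m0 fw; apply/FiltP; split; first by case: fw.
move=> v tv lv W; apply: contraTeq lv => nz.
by rewrite -leqNgt (eq_traj_len (summand_support m0 fw nz)).
Qed.

(** The part of [delta f] that raises the length, for f living on v. *)
Definition insertions m v (f : cochain X m) : cochain X m.+1 :=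
  \sum_(i < m.+2) (-1) ^+ i *: \sum_(e | insertable m i v e) cut i e (face i f).

Lemma insertions_Hcochain m v (f : cochain X m) :
  Hcochain f -> Hcochain (insertions v f).
Proof.
move=> Hf; apply: Hcochain_sum => i _; apply: HcochainZ.
have im : (i <= m.+1)%N by rewrite -ltnS.
by apply: Hcochain_sum => e _; apply: cut_Hcochain => //; exact: face_Hcochain.
Qed.

(** On v the i-th face of f vanishes unless removing v_i gives w, and then v is
    one step longer than w exactly when v_i was inserted strictly. *)
Lemma hat_rmul_insertions m (f : cochain X m) w v W : (0 < m)%N -> summand w f ->
  trajectory m.+1 v ->
  hat (insertions w f) (rmul m.+1 v W) =
  (traj_len m.+1 v == (traj_len m w).+1)%:R *: hat (delta f) (rmul m.+1 v W).
Proof.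
move=> m0 fw tv; rewrite delta_sum_face !hat_sum scaler_sumr.
apply: eq_bigr => i _; have im : (i <= m.+1)%N by rewrite -ltnS.
rewrite !hatZ scalerA mulrC -scalerA; congr (_ *: _); rewrite hat_sum.
have Hf : hat_linear (face i f).
  by apply: face_linear => //; case: fw => /Hcochain_linear.
under eq_bigr => e _ do rewrite hat_cut // rmul_idem //.
have -> : \sum_(e | insertable m i w e)
    hat (face i f) (upn (rmul m.+1 v W) i
      (if v i == e then rmul m.+1 v W i else 0)) =
  (insertable m i w (v i))%:R *: hat (face i f) (rmul m.+1 v W).
  rewrite big_mkcond (bigD1 (v i)) //= eqxx upn_id big1 ?addr0; last first.
    move=> e /negbTE ne; rewrite eq_sym ne hat_upn0 ?(leqW im) //; exact: if_same.
  by case: ifP; rewrite ?scale1r ?scale0r.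
case: (eqVneq (hat (face i f) (rmul m.+1 v W)) 0) => [->|nz].
  by rewrite !scaler0.
rewrite hat_face_rmul // in nz; have ev := summand_support m0 fw nz.
rewrite (traj_len_del_vertex tv im) (eq_traj_len ev) (eq_insertable _ im ev).
by rewrite -[(traj_len m w).+1]addn1 eqn_add2l eqb1.
Qed.

End Coef.
End Filtration.

(** * The blocks of the trajectory with given exponents *)

Section Blocks.
Variables (n t : nat) (kk : 'I_t.+1 -> 'I_n) (p : 'I_t.+1 -> nat).
Variable l : nat.
Hypothesis sum_p : (\sum_i p i)%N = l.
Hypothesis kk_incr : increasing kk.
Implicit Types (i j : 'I_t.+1).
Let v := traj_of kk p.
Let m := (l + t)%N.

(** The index at which the trajectory reaches k_j; since it descends, the blocks of
    larger index come first. *)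
Definition block_start (j : nat) : nat := \sum_(i < t.+1 | (j < i)%N) (p i).+1.
Local Notation pos := block_start.

Lemma drop_enum_gt (j : nat) i : i \in drop j.+1 (enum 'I_t.+1) -> (j < i)%N.
Proof.
move/(map_f val); rewrite map_drop val_enum_ord drop_iota mem_iota add0n.
by case/andP.
Qed.

Lemma take_enum_le (j : nat) i : i \in take j.+1 (enum 'I_t.+1) -> (i <= j)%N.
Proof.
move/(map_f val); rewrite map_take val_enum_ord take_iota mem_iota add0n /=.
by move=> lt; rewrite -ltnS (leq_trans lt) // geq_minl.
Qed.

Lemma size_blocks_after (j : nat) :
  size (flatten [seq nseq (p i).+1 (kk i) | i <- rev (drop j.+1 (enum 'I_t.+1))])
  = pos j.
Proof.
rewrite size_flatten sumnE /shape -map_comp big_map /pos big_rev /=.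
have -> : (\sum_(i < t.+1 | (j < i)%N) (p i).+1 =
    \sum_(i <- enum 'I_t.+1 | (j < i)%N) (p i).+1)%N by rewrite big_enum_cond.
rewrite -[in RHS](cat_take_drop j.+1 (enum 'I_t.+1)).
rewrite big_cat /= [X in _ = (X + _)%N]big_seq_cond [X in _ = (X + _)%N]big1 ?add0n;
  last first.
  by move=> i /andP[/take_enum_le ij]; rewrite ltnNge ij.
rewrite big_seq [RHS]big_seq_cond;
apply: eq_big => [i|i _]; last by rewrite size_nseq.
by case: (boolP (i \in _)) => //= /drop_enum_gt ->.
Qed.

Lemma traj_of_block j b : (b <= p j)%N -> v (pos j + b) = kk j.
Proof.
move=> bj; rewrite /v /traj_of.
have jt : (j < size (enum 'I_t.+1))%N by rewrite size_enum_ord.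
rewrite -(cat_take_drop j (enum 'I_t.+1)) (drop_nth j jt) nth_ord_enum.
rewrite rev_cat rev_cons cat_rcons map_cat flatten_cat nth_cat size_blocks_after.
rewrite ltnNge leq_addr /= addKn.
by case: b bj => // b bj; rewrite /= nth_cat size_nseq bj nth_nseq bj.
Qed.

Lemma block_start_step (j : 'I_t) :
  pos j = (pos (lift ord0 j) + (p (lift ord0 j)).+1)%N.
Proof.
rewrite /pos (bigD1 (lift ord0 j)) /= ?/bump ?add1n // addnC; congr (_ + _)%N.
apply: eq_bigl => i; rewrite [RHS]ltn_neqAle [RHS]andbC; congr (_ && _).
by rewrite eq_sym -val_eqE.
Qed.

Lemma block_start_max : pos t = 0%N.
Proof. by rewrite /pos big_pred0 // => i; rewrite ltnNge -ltnS ltn_ord. Qed.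

Lemma sum_succ : \sum_i (p i).+1 = m.+1.
Proof.
under eq_bigr => i _ do rewrite -addn1.
by rewrite big_split /= sum1_card card_ord /m -sum_p -addnS.
Qed.

Lemma block_end_le j : (pos j + (p j).+1 <= m.+1)%N.
Proof.
rewrite -sum_succ (bigID (fun i => (j < i)%N)) /= leq_add2l (bigD1 j) ?ltnn //=.
exact: leq_addr.
Qed.

Lemma block_end_last : (pos 0 + p ord0)%N = m.
Proof.
apply: succn_inj; rewrite -addnS -sum_succ (bigD1 ord0) //= addnC; congr (_ + _)%N.
by apply: eq_bigl => i; rewrite lt0n.
Qed.

Lemma in_block a : (a <= m)%N ->
  exists j b, (b <= p j)%N /\ a = (pos j + b)%N.
Proof.
rewrite -block_end_last => le.
suff H (d : nat) j : (t - j)%N = d -> (a <= pos j + p j)%N ->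
    exists j b, (b <= p j)%N /\ a = (pos j + b)%N by exact: H (erefl _) le.
elim: d j => [|d IHd] j dj aj.
  have jt : j = t :> nat.
    by apply/eqP; rewrite eqn_leq -{1}ltnS ltn_ord /= -subn_eq0 dj.
  exists j, a; rewrite jt block_start_max; split=> //.
  by move: aj; rewrite jt block_start_max.
case: (leqP (pos j) a) => [ja|aj'].
  by exists j, (a - pos j)%N; rewrite leq_subLR subnKC.
have jt : (j < t)%N by rewrite -subn_gt0 dj.
have step := block_start_step (Ordinal jt); rewrite /= in step.
apply: (IHd (lift ord0 (Ordinal jt))).
  by rewrite /= /bump add1n subnS dj.
by rewrite step addnS in aj'.
Qed.

Lemma increasing_inj i j : kk i = kk j -> i = j.
Proof.
move=> e; apply: val_inj; case: (ltngtP i j) => // /kk_incr.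
  by rewrite e ltnn.
by rewrite e ltnn.
Qed.

Lemma traj_of_start j : v (pos j) = kk j.
Proof. by rewrite -[pos j]addn0 traj_of_block. Qed.

Lemma traj_of_before (j : 'I_t) : v (pos j).-1 = kk (lift ord0 j).
Proof. by rewrite block_start_step addnS succnK traj_of_block. Qed.

Lemma block_start_gt0 (j : 'I_t) : (0 < pos j)%N.
Proof. by rewrite block_start_step addnS. Qed.

Lemma block_start_le j : (pos j <= m)%N.
Proof. by rewrite -ltnS (leq_trans _ (block_end_le j)) // addnS ltnS leq_addr. Qed.

Lemma traj_of_first : v 0 = kk ord_max.
Proof. by rewrite -(traj_of_start ord_max) block_start_max. Qed.

Lemma traj_of_last : v m = kk ord0.
Proof. by rewrite -block_end_last (traj_of_block (leqnn (p ord0))). Qed.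

Lemma jump_block a : (a < m)%N -> v a != v a.+1 ->
  exists j : 'I_t, a.+1 = pos j.
Proof.
move=> am ne; case: (in_block am) => j [b [bj e]].
case: b bj e => [|b] bj; rewrite ?addn0 ?addnS => e.
  have jt : (j < t)%N.
    rewrite ltn_neqAle -ltnS ltn_ord andbT; apply/eqP => jt.
    by move: e; rewrite jt block_start_max.
  by exists (Ordinal jt).
case: e => e; move: ne; rewrite e -addnS !traj_of_block ?eqxx //.
exact: ltnW.
Qed.

(** Sums over the paths of the trajectory localize at its t nontrivial paths, the
    last one before k_j being at index [block_start j] - 1. *)
Lemma sum_jumps (V : nmodType) (g : nat -> V) :
  (forall a, (a < m)%N -> v a = v a.+1 -> g a = 0) ->
  \sum_(a < m) g a = \sum_(j < t) g (pos j).-1.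
Proof.
move=> g0; transitivity (\sum_(a < m) \sum_(j < t | pos j == a.+1) g a).
  apply: eq_bigr => a _; case: (eqVneq (v a) (v a.+1)) => [e|ne].
    by rewrite g0 // big1.
  case: (jump_block (ltn_ord a) ne) => j ej.
  rewrite (big_pred1 j) // => j'; rewrite ej; apply/eqP/eqP => [e|-> //].
  apply: val_inj; have := traj_of_start (widen_ord (leqnSn t) j').
  rewrite /= e -[pos j]/(pos (widen_ord (leqnSn t) j)) traj_of_start.
  by move/increasing_inj/(congr1 val).
rewrite (exchange_big_dep predT) //=; apply: eq_bigr => j _.
have j0 := block_start_gt0 j.
have jm : ((pos j).-1 < m)%N.
  by rewrite prednK // (block_start_le (widen_ord (leqnSn t) j)).
rewrite (big_pred1 (Ordinal jm)) // => a; apply/eqP/eqP => [e|->].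
  by apply: val_inj; rewrite /= e.
by rewrite /= prednK.
Qed.

(** Each nontrivial path counts for one. *)
Lemma traj_len_of : traj_len m v = t.
Proof.
rewrite /traj_len (sum_jumps (V := nat) (g := fun a => (v a != v a.+1 : nat))).
  rewrite (eq_bigr (fun _ => 1%N)) ?sum1_card ?card_ord // => j _.
  rewrite prednK ?block_start_gt0 // traj_of_before.
  rewrite (traj_of_start (widen_ord (leqnSn t) j)).
  by case: eqP => // /increasing_inj/(congr1 val) /= /esym /eqP;
    rewrite /bump add1n ltn_eqF.
by move=> a _ ->; rewrite eqxx.
Qed.

(** The number q of factors to the left of M_(k_(j+1), k_j) precedes the start of
    the block of k_j by one. *)
Lemma block_startE (j : 'I_t) :
  pos j = (\sum_(i < t.+1 | (j < i)%N) p i + (t - j.+1)).+1.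
Proof.
rewrite -addnS subnSK // /pos; under eq_bigr => i _ do rewrite -addn1.
rewrite big_split /=; congr (_ + _)%N.
have -> : \sum_(i < t.+1 | (j < i)%N) 1%N = (\sum_(j.+1 <= i < t.+1) 1)%N.
  by rewrite big_geq_mkord.
by rewrite sum_nat_const_nat muln1 subSS.
Qed.

End Blocks.

(** * The three families of insertions *)

Section Formula.
Context {k : fieldType} {n : nat} {D : triangular k n}.
Local Notation T := (trimx D).
Variable X : bimod T T.
Implicit Types (v : nat -> 'I_n).

Lemma cut_face m i e (f : cochain X m) z : (i <= m.+1)%N ->
  cut i e (face i f) z =
  hat f (upn (fuse i (pad z)) i (pad z i * idem e * pad z i.+1)).
Proof. by move=> im; rewrite /cut hat_face // fuse_upn_eq. Qed.

(** The entry x of T at (k', v 0) is e_k' x e_(v 0), and the right idempotent is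
    absorbed by a summand on v; the same holds in [cupr_cut] and, on both sides, in
    [compmu_cut]. *)
Lemma cupl_cut m (f : cochain X m) v (k' : 'I_n) : (0 < m)%N -> summand v f ->
  (v 0 < k')%N -> cupl k' (v 0%N) f = cut 0 k' (face 0 f).
Proof.
move=> m0 fv lt; apply: funext => z.
rewrite cut_face // -(summand_right _ m0 (leq0n m) fv) upn_in upnn hat_upn_first.
rewrite fuse_gt // (pad_default z (leqnn _)) ract1 -[pad z 0]/1 mul1r.
rewrite (pad_ord z ord0) /cupl inM_lo //; congr (lact _ (f _)).
by apply: funext => a; rewrite /inner fuse_gt // -(pad_ord z).
Qed.

Lemma cupr_cut m (f : cochain X m) v (k0 : 'I_n) : (0 < m)%N -> summand v f ->
  (k0 < v m)%N -> cupr (v m) k0 f = cut m.+1 k0 (face m.+1 f).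
Proof.
move=> m0 fv lt; apply: funext => z.
rewrite cut_face // -(summand_left _ m0 (leqnn m) fv) upn_in upnn hat_upn_last.
rewrite fuse_lt // lact1 (pad_default z (leqnn _)) mulr1 mulrA.
rewrite -[m.+1]/(val (@ord_max m)).+1 pad_ord /cupr inM_lo //.
congr (ract (f _) _).
by apply: funext => a; rewrite /inner fuse_lt ?ltnS // -(pad_ord z).
Qed.

Lemma hat_contract m q (f : cochain X m) z y : (q < m)%N ->
  f (contract z q y) = hat f (upn (fuse q.+1 (pad z)) q.+1 y).
Proof.
move=> qm; have ne : m.+1 != q.+1 by rewrite gtn_eqF.
rewrite /hat (upn_out _ _ (isT : 0%N != q.+1)) (upn_out _ _ ne).
rewrite fuse_lt // lact1 fuse_gt ?ltnS // (pad_default z (leqnn _)) ract1.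
congr (f _); apply: funext => a; rewrite /inner /contract.
case: (ltngtP a q) => [aq|aq|->].
- by rewrite upn_out ?ltn_eqF // fuse_lt // -(pad_ord z).
- by rewrite upn_out ?gtn_eqF // fuse_gt // -(pad_ord z).
by rewrite upn_in.
Qed.

Lemma compmu_cut m q (f : cochain X m) v (e : 'I_n) : (q < m)%N -> summand v f ->
  (v q.+1 < e < v q)%N ->
  compmu q (v q) e (v q.+1) f = cut q.+1 e (face q.+1 f).
Proof.
move=> qm fv lt; have m0 : (0 < m)%N by exact: leq_ltn_trans qm.
apply: funext => z; rewrite cut_face ?ltnS ?(ltnW qm) //.
rewrite !pad_inord ?ltnS //; last exact: ltnW.
rewrite /compmu inM_tmu // hat_contract //.
rewrite -[RHS](summand_left _ m0 (ltnW qm) fv) upn_in upnn.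
by rewrite -[RHS](summand_right _ m0 qm fv) upn_in upnn.
Qed.

(** Strict insertions at index 0, at the last index, and in between, where only
    the starts of blocks leave room for a vertex. *)
Lemma d1_term (t l : nat) (kk : 'I_t.+1 -> 'I_n) (p : 'I_t.+1 -> nat)
    (f : cochain X (l + t)) :
  (0 < t)%N -> increasing kk -> (\sum_i p i)%N = l ->
  summand (traj_of kk p) f ->
  (\sum_(k' < n | (kk ord_max < k')%N) cupl k' (kk ord_max) f
    + \sum_(k0 < n | (k0 < kk ord0)%N)
        (-1) ^+ (l + t).+1 *: cupr (kk ord0) k0 f
    + \sum_(i < t)
       \sum_(a < n | (kk (widen_ord (leqnSn t) i) < a < kk (lift ord0 i))%N)
         let q := (\sum_(j < t.+1 | (i < j)%N) p j + (t - i.+1))%N in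
         (-1) ^+ q.+1 *:
           compmu q (kk (lift ord0 i)) a (kk (widen_ord (leqnSn t) i)) f)%R
  = insertions (traj_of kk p) f.
Proof.
move=> t0 kki sp fv; have m0 : (0 < l + t)%N by rewrite addn_gt0 t0 orbT.
set m := (l + t)%N in f fv m0 *; set v := traj_of kk p in fv *.
have vfirst : v 0%N = kk ord_max := traj_of_first kk p.
have vlast : v m = kk ord0 := traj_of_last kk sp.
rewrite /insertions big_ord_recl big_ord_recr /= -addrA [X in _ + X]addrC.
congr (_ + (_ + _)).
- rewrite expr0 scale1r; apply: eq_big => [e|e lt].
    by rewrite /insertable /= vfirst.
  by rewrite -vfirst cupl_cut // vfirst.
- transitivity (\sum_(a < m) (-1) ^+ a.+1 *:
      \sum_(e : 'I_n | (v a.+1 < e < v a)%N) cut a.+1 e (face a.+1 f)); last first.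
    apply: eq_bigr => a _; rewrite /bump add1n; congr (_ *: _).
    apply: eq_bigl => e.
    by rewrite /insertable /= eqSS (ltn_eqF (ltn_ord a)) /= andbC.
  rewrite (sum_jumps sp kki (g := fun a => (-1) ^+ a.+1 *:
      \sum_(e : 'I_n | (v a.+1 < e < v a)%N) cut a.+1 e (face a.+1 f))); last first.
    move=> a _ e; rewrite -/v in e; rewrite -e big_pred0 ?scaler0 // => b.
    by case: ltngtP.
  apply: eq_bigr => j _.
  have := traj_of_before kk p j; rewrite -/v.
  have := traj_of_start kk p (widen_ord (leqnSn t) j); rewrite -/v /=.
  have := block_start_le sp (widen_ord (leqnSn t) j); rewrite /= -/m.
  rewrite block_startE /=; set q := (_ + _)%N => qm vq' vq.
  rewrite scaler_sumr vq vq'; apply: eq_bigr => e lt.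
  by rewrite -vq -vq' compmu_cut // vq vq'.
rewrite /bump add1n -scaler_sumr; congr (_ *: _); apply: eq_big => [e|e lt].
  by rewrite /insertable /= vlast eqxx andbT.
by rewrite -vlast cupr_cut // vlast.
Qed.

Lemma d1_formula_insertions (t l : nat) (kk : 'I_t.+1 -> 'I_n)
    (f : {ffun 'I_t.+1 -> 'I_l.+1} -> cochain X (l + t)) :
  (0 < t)%N -> increasing kk ->
  (forall p, exponents p -> summand (traj_of kk (fun i => p i)) (f p)) ->
  d1_formula kk f =
  \sum_(p | exponents p) insertions (traj_of kk (fun i => p i)) (f p).
Proof.
move=> t0 kki fp; apply: eq_bigr => p ep.
by rewrite -d1_term //; [exact/eqP | exact: fp].
Qed.

End Formula.

(** * Cosets in the spectral sequence *)

Section Pages.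
Context {k : fieldType} {n : nat} {D : triangular k n}.
Local Notation T := (trimx D).
Variable X : bimod T T.

Lemma Filt_sum s m (I : Type) (r : seq I) (P : pred I) (F : I -> cochain X m) :
  (forall u, P u -> Filt s (F u)) -> Filt s (\sum_(u <- r | P u) F u).
Proof.
move=> HF; elim/big_rec: _ => [|u f Pu Hf]; first exact: Filt0.
by rewrite -[F u]scale1r; apply: Filt_lin => //; exact: HF.
Qed.

Lemma delta_lin m c (f g : cochain X m) :
  delta (c *: f + g) = c *: delta f + delta g.
Proof. by rewrite deltaD deltaZ. Qed.

Lemma Zr_lin r s m c (f g : cochain X m) :
  Zr r s f -> Zr r s g -> Zr r s (c *: f + g).
Proof.
move=> [Ff Fdf] [Fg Fdg]; split; first exact: Filt_lin.
by rewrite delta_lin; exact: Filt_lin.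
Qed.

Lemma Br_lin r s m c (f g : cochain X m) :
  Br r s f -> Br r s g -> Br r s (c *: f + g).
Proof.
case: m f g => [|m] f g; first by rewrite /Br /= => -> ->; rewrite scaler0 addr0.
move=> [f' [Ff Fdf ->]] [g' [Fg Fdg ->]]; exists (c *: f' + g'); split.
- exact: Filt_lin.
- by rewrite delta_lin; exact: Filt_lin.
by rewrite delta_lin.
Qed.

Lemma Br0 r s m : Br r s (0 : cochain X m).
Proof.
case: m => [//|m]; exists 0.
have -> : delta (0 : cochain X m) = 0 by rewrite -[0 in LHS](scale0r 0) deltaZ scale0r.
by split=> //; exact: Filt0.
Qed.

Lemma Er_zero_lin r s m c (f g : cochain X m) :
  Er_zero r s f -> Er_zero r s g -> Er_zero r s (c *: f + g).
Proof.
move=> [x [y [Zx By ->]]] [x' [y' [Zx' By' ->]]].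
exists (c *: x + x'), (c *: y + y'); split; [exact: Zr_lin | exact: Br_lin |].
by rewrite scalerDr addrACA.
Qed.

Lemma Er_zero_Zr r s m (f : cochain X m) : Zr r.-1 s.+1 f -> Er_zero r s f.
Proof. by move=> Zf; exists f, 0; split; rewrite ?addr0 //; exact: Br0. Qed.

Lemma Er_zeroN r s m (f : cochain X m) : Er_zero r s f -> Er_zero r s (- f).
Proof.
move=> Ef; rewrite -scaleN1r -[_ *: _]addr0; apply: Er_zero_lin => //.
by rewrite -[0](subrr f) -scaleN1r addrC; exact: Er_zero_lin.
Qed.

Lemma Er_zeroD r s m (f g : cochain X m) :
  Er_zero r s f -> Er_zero r s g -> Er_zero r s (f + g).
Proof. by move=> Ef Eg; rewrite -[f]scale1r; exact: Er_zero_lin. Qed.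

Lemma delta_Br r s m (f : cochain X m) : Br r s f -> delta f = 0.
Proof.
case: m f => [|m] f; last by case=> g [_ _ ->]; exact: deltaK.
by move=> ->; rewrite -[0 in LHS](scale0r 0) deltaZ scale0r.
Qed.

Lemma Br_Filt r s m (f : cochain X m) : Br r s f -> Filt s f.
Proof.
by case: m f => [|m] f; [move=> ->; exact: Filt0 | case=> g [_ Fd ->]].
Qed.

(** Altering a cochain by an element representing zero in E_1 keeps it in Z_1, as
    a boundary has zero coboundary. *)
Lemma Er_zero1_Zr s m (f : cochain X m) : Er_zero 1 s f -> Zr 1 s f.
Proof.
move=> [x [y [[Fx Fdx] By ->]]]; rewrite addn0 in Fdx.
rewrite -[x]scale1r; apply: Zr_lin; split.
- exact: FiltW Fx.
- by rewrite addn1.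
- exact: Br_Filt By.
by rewrite (delta_Br By); exact: Filt0.
Qed.

Lemma Er_class_eq r s m (f g : cochain X m) :
  Er_zero r s (f - g) -> Er_class r s f = Er_class r s g.
Proof.
move=> E; rewrite /Er_class; apply/seteqP; split=> h [Zh Eh]; split=> //.
  by rewrite -[h](subrK f) -addrA; exact: Er_zeroD.
by rewrite -[h](subrK g) -addrA -[g - f]opprB; apply/Er_zeroD/Er_zeroN.
Qed.

Lemma Er_class_refl s m (f : cochain X m) : Zr 1 s f -> Er_class 1 s f f.
Proof.
move=> Zf; split=> //; rewrite subrr; apply: Er_zero_Zr.
rewrite -[0](subrr 0) -scaleN1r addrC; split; rewrite ?delta_lin.
  by apply: Filt_lin; exact: Filt0.
by apply: Filt_lin; rewrite (delta_Br (Br0 0 0 m)); exact: Filt0.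
Qed.

(** Two representatives of a class differ by x of filtration s+1 and by a
    boundary; their coboundaries then differ by delta x, which is zero in E_1. So
    the coboundary of a single representative determines d_1. *)
Lemma dr_class s m (f : cochain X m) (g : cochain X m.+1) : Zr 1 s f ->
  Er_zero 1 s.+1 (delta f - g) -> dr 1 s (Er_class 1 s f) = Er_class 1 s.+1 g.
Proof.
move=> Zf Efg; rewrite /dr addn1; apply/seteqP;
  split=> [h' [f' [_ Ef'] Ch']|h' Ch'].
  rewrite -(Er_class_eq (f := delta f')) //.
  rewrite -[delta f'](subrK (delta f)) -addrA; apply: Er_zeroD => //.
  case: Ef' => x [y [[Fx Fdx] By e]].
  rewrite addrC -scaleN1r -delta_lin scaleN1r addrC e -[x]scale1r delta_lin.
  rewrite scale1r (delta_Br By) addr0; rewrite addn0 in Fdx.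
  exists 0, (delta x); split; rewrite ?add0r //.
    split; rewrite ?(delta_Br (Br0 0 0 m.+1)); exact: Filt0.
  by exists x; split; rewrite ?subn1.
exists f; first exact: Er_class_refl.
by rewrite (Er_class_eq Efg).
Qed.

End Pages.

(** * Cocycles coming from a resolution *)

Section Pushforward.
Context {k : fieldType} {n : nat} {D : triangular k n}.
Local Notation T := (trimx D).
Local Notation A := (diagA D).
Variables (Y X : bimod T T) (xi : {linear Y -> X}).
(* Diagonal elements only: a cocycle on a resolution is linear over A_j and A_i,
   but need not respect the action of the off-diagonal part of T on X. *)
Hypothesis xi_l : forall i (a : A i) y, xi (lact (inA a) y) = lact (inA a) (xi y).
Hypothesis xi_r : forall i (a : A i) y, xi (ract y (inA a)) = ract (xi y) (inA a).

Definition push m (f : cochain Y m) : cochain X m := fun z => xi (f z).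

Lemma push_subR_l r y : subR r -> xi (lact r y) = lact r (xi y).
Proof.
case=> c ->; apply: (big_rec (fun r => xi (lact r y) = lact r (xi y))).
  by rewrite !act0l linear0.
by move=> i r' _ IH; rewrite !lact_linl linearP IH xi_l.
Qed.

Lemma push_subR_r r y : subR r -> xi (ract y r) = ract (xi y) r.
Proof.
case=> c ->; apply: (big_rec (fun r => xi (ract y r) = ract (xi y) r)).
  by rewrite !act0r linear0.
by move=> i r' _ IH; rewrite !ract_linr linearP IH xi_r.
Qed.

Lemma push_Hcochain m (f : cochain Y m) : Hcochain f -> Hcochain (push f).
Proof.
move=> [mf bal left right zero]; split; rewrite /push.
- by move=> z a c x y; rewrite mf linearP.
- by move=> z a b r rR eb; rewrite (bal z a b r).
- by move=> z a r rR a0; rewrite left // push_subR_l.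
- by move=> z a r rR am; rewrite right // push_subR_r.
by move=> z r rR m0; rewrite -push_subR_l // zero // push_subR_r.
Qed.

Lemma push_Filt s m (f : cochain Y m) : Filt s f -> Filt s (push f).
Proof.
move=> [Hf vf]; split; first exact: push_Hcochain.
move=> v tv lv z; rewrite /push -push_subR_l; last exact: subR_idem.
by rewrite vf // linear0.
Qed.

Lemma vanishes_on_tproj (Z : bimod T T) m (f : cochain Z m) v z : (0 < m)%N ->
  Hcochain f -> vanishes_on v f -> f (tproj v z) = 0.
Proof.
case: m f z => // m f z _ [_ _ left _ _] vf.
rewrite -[RHS](vf z) -(left _ ord0 _ (subR_idem _)) //; congr f.
apply: funext => a; rewrite /upd; case: eqP => // ->.
by rewrite /tproj !mulrA idemK.
Qed.

(** Only the outer terms of the coboundary involve the action of T on values. Such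
    a term has a diagonal factor, with which xi commutes, or else the remaining
    trajectory has length below s and f vanishes on it. *)
Lemma delta_push s m (f : cochain Y m) v z : (0 < m)%N -> Filt s f ->
  trajectory m.+1 v -> (traj_len m.+1 v <= s)%N ->
  delta (push f) (tproj v z) = xi (delta f (tproj v z)).
Proof.
move=> m0 [Hf vf] tv lv; rewrite /delta !linearD linear_sum /push.
congr (_ + _ + _).
- set w := fun a : 'I_m => _;
  have -> : w = tproj (fun a => v a.+1) (fun a => z (lift ord0 a)) by [].
  rewrite {1 3}/tproj /=; case: (eqVneq (v 0%N) (v 1%N)) => [<-|ne].
    by rewrite corner_diag xi_l.
  rewrite [f _](vanishes_on_tproj _ m0 Hf) ?linear0 ?lact0 ?linear0 //.
  apply: vf => [a am|]; first exact: tv.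
  by move: lv; rewrite traj_lenS ne.
- by apply: eq_bigr => i _; rewrite linearZ.
rewrite linearZ; congr (_ *: _).
set w := fun a : 'I_m => _;
have -> : w = tproj v (fun a => z (widen_ord (leqnSn m) a)) by [].
rewrite {2 4}/tproj /=; case: (eqVneq (v m) (v m.+1)) => [<-|ne].
  by rewrite corner_diag xi_r.
rewrite [f _](vanishes_on_tproj _ m0 Hf) ?linear0 ?ract0 ?linear0 //.
apply: vf => [a am|]; first by apply: tv; exact: leqW.
by move: lv; rewrite /traj_len big_ord_recr /= ne addn1.
Qed.

End Pushforward.

(** * The differential on a component *)

Section Main.
Context {k : fieldType} {n : nat} {D : triangular k n}.
Local Notation T := (trimx D).
Local Notation A := (diagA D).
Variables (t : nat) (kk : 'I_t.+1 -> 'I_n).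
Hypotheses (t_gt0 : (0 < t)%N) (kk_incr : increasing kk).

Lemma component_Filt (X : bimod T T) l (F : cochain X (l + t)) :
  component kk F -> Filt t F.
Proof.
move=> [f fv ->]; apply: Filt_sum => p ep.
have m0 : (0 < l + t)%N by rewrite addn_gt0 t_gt0 orbT.
have := summand_Filt m0 (fv p ep).
by rewrite (traj_len_of (eqP ep) kk_incr).
Qed.

(** The diagonal algebras at other vertices than k_t act by zero on the inflation,
    and also on the image of xi, which is contained in e_(k_t) X. *)
Lemma inflation_linear_l (W : bimod (A (kk ord_max)) (A (kk ord0)))
    (X : bimod T T) (xi : {linear W -> X}) :
  (forall b y, xi (lact b y) = lact (inA b) (xi y)) ->
  forall i (a : A i) (y : inflation W),
    xi (lact (inA a : T) y) = lact (inA a) (xi y).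
Proof.
move=> hl i a y.
rewrite (_ : lact (inA a : T) y = lact (dg (inA a : T) (kk ord_max)) (y : W)) //.
rewrite dg_inA; case: (eqVneq i (kk ord_max)) => [e|ne].
  by subst i; rewrite dfwith_in hl.
rewrite dfwith_out // act0l linear0 -[y in RHS](lact1 (V := W)) hl -lactM
  -[inA 1]/(idem (kk ord_max)).
have -> : inA a = idem i * inA a * idem i :> T.
  by rewrite corner_diag dg_inA dfwith_in.
by rewrite -!mulrA idem_mul (negbTE ne) !mulr0 act0l.
Qed.

Lemma inflation_linear_r (W : bimod (A (kk ord_max)) (A (kk ord0)))
    (X : bimod T T) (xi : {linear W -> X}) :
  (forall y b, xi (ract y b) = ract (xi y) (inA b)) ->
  forall i (a : A i) (y : inflation W),
    xi (ract y (inA a : T)) = ract (xi y) (inA a).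
Proof.
move=> hr i a y.
rewrite (_ : ract y (inA a : T) = ract (y : W) (dg (inA a : T) (kk ord0))) //.
rewrite dg_inA; case: (eqVneq i (kk ord0)) => [e|ne].
  by subst i; rewrite dfwith_in hr.
rewrite dfwith_out // act0r linear0 -[y in RHS](ract1 (V := W)) hr -ractM
  -[inA 1]/(idem (kk ord0)).
have -> : inA a = idem i * inA a * idem i :> T.
  by rewrite corner_diag dg_inA dfwith_in.
by rewrite !mulrA idem_mul eq_sym (negbTE ne) !mul0r act0r.
Qed.

Lemma represents_Ext_Zr (X : bimod T T) l (F : cochain X (l + t)) :
  represents_Ext kk F -> Zr 1 t F.
Proof.
move=> [N [u [P [phi [xi [_ cphi _ dphi [hl hr xid eF]]]]]]].
have xl := inflation_linear_l hl; have xr := inflation_linear_r hr.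
have m0 : (0 < l + t)%N by rewrite addn_gt0 t_gt0 orbT.
have Fphi := component_Filt (cphi l).
pose G : cochain X (l + t) := push (xi : {linear inflation (P l) -> X}) (phi l).
have FG : Filt t G := push_Filt xl xr Fphi.
have ZG : Zr 1 t G.
  split=> //; rewrite addn1; split; first by apply: delta_Hcochain; case: FG.
  move=> v tv lv z; rewrite (delta_push xl xr z m0 Fphi tv lv).
  rewrite -xl; have [_ /(_ v tv lv z)] := dphi l.
  rewrite -scaleN1r addrC lact_linr scaleN1r addrC => /subr0_eq <-.
  by rewrite xl xid lact0.
have : Er_class 1 t F G by rewrite eF; exact: Er_class_refl.
case=> _ /Er_zero1_Zr ZGF.
by rewrite -[F](subKr G) addrC -scaleN1r; exact: Zr_lin.
Qed.

(** In length t+1 the two sides agree; in smaller length the insertions vanish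
    and so does [delta F], F being in Z_1. *)
Lemma delta_sub_insertions (X : bimod T T) l
    (f : {ffun 'I_t.+1 -> 'I_l.+1} -> cochain X (l + t))
    (f_comp : forall p, exponents p ->
       summand (traj_of kk (fun i => p i)) (f p)) :
  let F := \sum_(p | exponents p) f p in
  Zr 1 t F -> Filt t.+2 (delta F - d1_formula kk f).
Proof.
move=> F [FF FdF]; rewrite d1_formula_insertions //; apply/FiltP; split.
  rewrite -scaleN1r addrC; apply: Hcochain_lin.
    by apply: Hcochain_sum => p ep; apply: insertions_Hcochain; case: (f_comp p ep).
  by apply: delta_Hcochain; case: FF.
move=> v tv lv W; have m0 : (0 < l + t)%N by rewrite addn_gt0 t_gt0 orbT.
rewrite -scaleN1r hatD hatZ scaleN1r hat_sum.
rewrite (eq_bigr (fun p => (traj_len (l + t).+1 v == t.+1)%:R *: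
    hat (delta (f p)) (rmul (l + t).+1 v W))); last first.
  move=> p ep; rewrite (hat_rmul_insertions _ m0 (f_comp p ep) tv).
  by rewrite (traj_len_of (eqP ep)).
rewrite -scaler_sumr -hat_sum -(big_morph (@delta _ _ _ X _)
  (@deltaD _ _ _ X _) (delta_Br (Br0 X 0 0 _))) -/F.
case: eqVneq => [_|ne]; first by rewrite scale1r subrr.
rewrite scale0r subr0; rewrite addn1 in FdF.
by move/FiltP: FdF => [_]; apply=> //; rewrite ltn_neqAle ne -ltnS.
Qed.

End Main.

Theorem proposition4p12 (k : fieldType) (n : nat) (D : triangular k n)
    (n_ge3 : (3 <= n)%N) (X : bimod (trimx D) (trimx D))
    (projD : projectivity_hypothesis D)
    (t : nat) (t_gt0 : (0 < t)%N)
    (kk : 'I_t.+1 -> 'I_n) (kk_incr : increasing kk)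
    (l : nat) (f : {ffun 'I_t.+1 -> 'I_l.+1} -> cochain X (l + t))
    (f_comp : forall p, exponents p ->
       summand (traj_of kk (fun i => p i)) (f p)) :
  let F := \sum_(p | exponents p) f p in
  (represents_Ext kk F -> Zr 1 t F) /\
  (Zr 1 t F ->
   dr 1 t (Er_class 1 t F) = Er_class 1 t.+1 (d1_formula kk f)).
Proof.
move=> F; split; first exact: represents_Ext_Zr.
move=> ZF; have G2 := delta_sub_insertions t_gt0 kk_incr f_comp ZF.
apply: dr_class => //; apply: Er_zero_Zr; split=> //.
by rewrite addn0; exact: Filt_delta.
Qed.
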